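(* Let $X$ be a finite, nonempty symmetric $\Delta$-complex and let $H_X$ be the Hasse diagram of the poset of symmetric orbits of $X$ (not including the empty set), regarded as a graph. Let $M$ be a permissible acyclic matching on $H_X$. Then $|X|$ is homotopy equivalent to a symmetric CW-complex with exactly one $p$-cell $(B^p)^\circ/G$ for each symmetric orbit of $p$-simplices $[\sigma]$ that is not matched in $M$, where $G\subset O(p)$ is finite and isomorphic to $\operatorname{Aut}(\sigma)$.
   Context: Symmetric $\Delta$-complexes. Put $[p]=\{0,1,\dots,p\}$ for $p\ge 0$ and $[-1]=\emptyset$. Let $I$ be the category with objects $[p]$, $p\geq -1$, and morphisms all injections. A symmetric $\Delta$-complex is a functor $X: I^{\mathrm{op}}\to \mathrm{Sets}$. Write $X_p=X([p])$ and $\theta^*=X(\theta):X_q\to X_p$ for an injection $\theta:[p]\to[q]$. A $p$-simplex ($p\ge 0$) is an element $\alpha\in X_p$, also written $\alpha^{(p)}$. $X$ is finite (nonempty) if it has finitely many simplices (at least one simplex) of dimension $\ge 0$. The symmetric orbit of $\alpha\in X_p$ is $[\alpha]=\{\rho^*(\alpha):\rho\in S_{p+1}\}$, where $S_{p+1}$ is the group of permutations of $[p]$. If $\theta^*(\beta)=\alpha$ for an injection $\theta$, we say that $\theta$ glues $\alpha$ to $\beta$ and $\alpha$ is a face of $\beta$, written $\alpha<\beta$; this depends only on the orbits and induces a partial order on the set of symmetric orbits of simplices of dimension $\ge0$ (the poset of symmetric orbits). $\operatorname{Aut}(\alpha)=\{\rho\in S_{p+1}:\rho^*(\alpha)=\alpha\}$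 for $\alpha\in X_p$. Geometric realization. For $\theta:[p]\to[q]$ let $\theta_*:\Delta^p\to\Delta^q$ be the induced affine map of standard simplices, $e_i\mapsto e_{\theta(i)}$. Then $|X|=\left(\coprod_{p\ge 0} X_p\times\Delta^p\right)/\sim$, where $(x,\theta_*a)\sim(\theta^*x,a)$ for $x\in X_q$, $\theta:[p]\to[q]$ an injection and $a\in\Delta^p$. Permissible faces. Let $\rho$ glue $\alpha^{(p)}$ to $\beta^{(p+1)}$ ($p\ge0$). Then $\alpha$ is a permissible face of $\beta$ if: (1) any two injections $\theta,\theta':[p]\to[p+1]$ with $\theta^*(\beta)=(\theta')^*(\beta)=\alpha$ satisfy $\operatorname{Im}\theta=\operatorname{Im}\theta'$; (2) the map $f_\rho:\operatorname{Aut}(\beta)\to\operatorname{Aut}(\alpha)$, $f_\rho(\pi)=\rho^{-1}|_{\operatorname{Im}\rho}\circ\pi\circ\rho$ (well defined given (1)), is an isomorphism. Permissibility depends only on the symmetric orbits. Matchings. For a poset $P$, write $a\prec b$ if $a<b$ and there is no $c$ with $a<c<b$. A (partial) matching on $P$ (equivalently on its Hasse diagram) is a subset $M\subset P\times P$ such that $(a,b)\in M$ implies $a\prec b$, and each element of $P$ belongs to at most one pair in $M$. If $(a,b)\in M$ write $a=d(b)$. $M$ is acyclic if there is no cycle $b_1\succ d(b_1)\prec b_2\succ d(b_2)\prec\cdots\prec b_n\succ d(b_n)\prec b_1$ with $n\ge2$ and all $b_i\in P$ distinct. A matching $M$ on the poset of symmetric orbits of $X$ is permissible if for every $([\alpha^{(p)}],[\beta^{(p+1)}])\in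 M$, $\alpha$ is a permissible face of $\beta$. An orbit is matched in $M$ if it belongs to some pair in $M$. Symmetric CW-complexes. $B^p$ is the closed unit ball in $\mathbb{R}^p$, $(B^p)^\circ$ its interior, and $O(p)$ the orthogonal group. A symmetric CW-complex is a Hausdorff topological space $Y$ with a partition into locally closed cells such that for each cell $C$ there are $p\ge 0$, a finite subgroup $G\subset O(p)$ and a continuous map $B^p/G\to Y$ such that $(B^p)^\circ/G$ maps homeomorphically onto $C$ (then $C$ is called a $p$-cell $(B^p)^\circ/G$) and the image of the boundary $\partial B^p/G$ meets only finitely many cells, each of dimension less than $p$; moreover a subset of $Y$ is closed if and only if its intersection with the closure of each cell is closed. *)

(* Defs.v *)
From HB Require Import structures.
From Stdlib Require Import Relations.
From mathcomp Require Import all_boot all_order all_fingroup all_algebra.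
From mathcomp Require Import all_classical all_reals topology normedtype.

Set Implicit Arguments.
Unset Strict Implicit.
Unset Printing Implicit Defensive.

Import Order.TTheory GRing.Theory Num.Theory.
Import numFieldNormedType.Exports.

Local Open Scope classical_set_scope.
Local Open Scope ring_scope.

(** Morphisms of the category [I]: the object [[p]] = {0, ..., p} is encoded as
    ['I_p.+1] and [[-1]] as ['I_0], so objects are indexed by cardinality. *)
Definition inj_ord (m n : nat) : Type :=
  {f : {ffun 'I_m -> 'I_n} | injectiveb f}.

Definition mk_inj m n (f : {ffun 'I_m -> 'I_n}) (f_inj : injectiveb f) :
  inj_ord m n := exist (fun f : {ffun 'I_m -> 'I_n} => injectiveb f) f f_inj.

Definition inj_fun m n (f : inj_ord m n) : 'I_m -> 'I_n := val f.
Coercion inj_fun : inj_ord >-> Funclass.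

Lemma inj_inj m n (f : inj_ord m n) : injective f.
Proof. exact/injectiveP/(valP f). Qed.

Lemma inj_id_subproof n : injectiveb [ffun i : 'I_n => i].
Proof. by apply/injectiveP => i j; rewrite !ffunE. Qed.

Definition inj_id n : inj_ord n n := mk_inj (inj_id_subproof n).

Lemma inj_comp_subproof l m n (g : inj_ord m n) (f : inj_ord l m) :
  injectiveb [ffun i => g (f i)].
Proof.
by apply/injectiveP => i j; rewrite !ffunE => /inj_inj/inj_inj.
Qed.

Definition inj_comp l m n (g : inj_ord m n) (f : inj_ord l m) : inj_ord l n :=
  mk_inj (inj_comp_subproof g f).

Definition inj_of_perm n (s : 'S_n) : inj_ord n n := mk_inj (valP s).

Lemma inj_ext m n (f g : inj_ord m n) : f =1 g -> f = g.
Proof. by move=> fg; apply/val_inj/ffunP => i; exact: fg. Qed.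

Lemma inj_of_permE n (s : 'S_n) i : inj_of_perm s i = s i.
Proof. by rewrite /inj_fun /= pvalE. Qed.

Lemma perm_of_inj n (f : inj_ord n n) : exists s : 'S_n, f = inj_of_perm s.
Proof.
exists (perm (@inj_inj _ _ f)); apply/inj_ext => i.
by rewrite inj_of_permE permE.
Qed.

(** [cells X n] is [X([n-1])]; in particular [cells X 0] is [X([-1])] and
    [cells X p.+1] is the set of [p]-simplices. *)
Record sym_delta_complex := SymDeltaComplex {
  cells : nat -> Type;
  res : forall m n, inj_ord m n -> cells n -> cells m;
  res_id : forall n (x : cells n), res (inj_id n) x = x;
  res_comp : forall l m n (g : inj_ord m n) (f : inj_ord l m) (x : cells n),
    res (inj_comp g f) x = res f (res g x)
}.
Arguments res X {m n} : rename.

HB.instance Definition _ (X : sym_delta_complex) n := gen_eqMixin (cells X n).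
HB.instance Definition _ (X : sym_delta_complex) n :=
  gen_choiceMixin (cells X n).

Definition simplex (X : sym_delta_complex) : Type := {p : nat & cells X p.+1}.

Section Orbits.
Variable X : sym_delta_complex.

Definition mk_simplex p (x : cells X p.+1) : simplex X := existT _ p x.

Definition orbit_set (s : simplex X) : set (simplex X) :=
  range (fun rho : 'S_(tag s).+1 =>
    mk_simplex (res X (inj_of_perm rho) (tagged s))).

Definition is_face (s t : simplex X) : Prop :=
  exists theta : inj_ord (tag s).+1 (tag t).+1, res X theta (tagged t) = tagged s.

Definition sorbit : Type := set_type (range orbit_set).
HB.instance Definition _ := Choice.on sorbit.

Definition sorbit_of (s : simplex X) : sorbit := SigSub (mem_set (imageT orbit_set s)).

Definition sorbit_le (a b : sorbit) : bool :=
  `[< exists s t, [/\ val a s, val b t & is_face s t] >].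

Lemma orbit_set_refl s : orbit_set s s.
Proof.
case: s => p x; exists 1%g => //=; congr existT; rewrite -[RHS]res_id.
by congr res; apply/inj_ext => i; rewrite inj_of_permE perm1 /inj_fun /= ffunE.
Qed.

Lemma is_face_trans t s u : is_face s t -> is_face t u -> is_face s u.
Proof.
move=> [f fE] [g gE]; exists (inj_comp g f).
by rewrite res_comp gE.
Qed.

Lemma is_face_dim s t : is_face s t -> (tag s <= tag t)%N.
Proof.
move=> [f _]; rewrite -ltnS.
by have := leq_card _ (@inj_inj _ _ f); rewrite !card_ord.
Qed.

Lemma orbit_set_face s t : orbit_set s t -> is_face t s.
Proof. by move=> [rho _ <-]; exists (inj_of_perm rho). Qed.

Lemma orbit_setP s t : orbit_set s t <-> is_face t s /\ tag s = tag t.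
Proof.
split=> [st|]; first by split; [exact: orbit_set_face|case: st => rho _ <-].
case: s t => p x [q y] [[/= f fE] pq]; case: _ / pq in y f fE *.
by have [rho fr] := perm_of_inj f; exists rho => //=; rewrite -fr fE.
Qed.

Lemma orbit_set_sym s t : orbit_set s t -> orbit_set t s.
Proof.
case: s => p x [rho _ <-] /=; exists (rho^-1)%g => //=; congr existT.
rewrite -res_comp -[RHS]res_id; congr res; apply/inj_ext => i.
by rewrite /inj_fun /= !ffunE !inj_of_permE permKV.
Qed.

Lemma orbit_set_trans t s u : orbit_set s t -> orbit_set t u -> orbit_set s u.
Proof.
move=> /orbit_setP[ts st] /orbit_setP[ut tu]; apply/orbit_setP.
by split; [exact: is_face_trans ut ts|rewrite st].
Qed.

Lemma orbit_set_eq s t : orbit_set s t -> orbit_set s = orbit_set t.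
Proof.
move=> st; apply/seteqP; split=> u; apply: orbit_set_trans => //.
exact: orbit_set_sym.
Qed.

Lemma sorbit_valP (a : sorbit) s : val a s -> val a = orbit_set s.
Proof. by case: a => A /= /set_mem[t _ <-] /orbit_set_eq. Qed.

Lemma sorbit_leP (a b : sorbit) s t : val a s -> val b t ->
  sorbit_le a b <-> is_face s t.
Proof.
move=> as_ bt; split=> [/asboolP[s' [t' [as' bt' st']]]|st].
  apply: (@is_face_trans s'); last apply: (@is_face_trans t') => //.
    by apply: orbit_set_face; rewrite -(sorbit_valP as').
  by apply: orbit_set_face; rewrite -(sorbit_valP bt).
by apply/asboolP; exists s, t.
Qed.

Lemma sorbit_nonempty (a : sorbit) : exists s, val a s.
Proof. by case: a => A /= /set_mem[s _ <-]; exists s; exact: orbit_set_refl. Qed.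

Lemma sorbit_le_refl : reflexive sorbit_le.
Proof.
move=> a; have [s as_] := sorbit_nonempty a.
by apply/(sorbit_leP as_ as_); exact/orbit_set_face/orbit_set_refl.
Qed.

Lemma sorbit_le_anti : antisymmetric sorbit_le.
Proof.
move=> a b /andP[]; have [s as_] := sorbit_nonempty a.
have [t bt] := sorbit_nonempty b.
move=> /(sorbit_leP as_ bt) st /(sorbit_leP bt as_) ts.
apply/val_inj; rewrite (sorbit_valP as_) (sorbit_valP bt); apply: orbit_set_eq.
by apply/orbit_setP; split=> //; apply/anti_leq; rewrite !is_face_dim.
Qed.

Lemma sorbit_le_trans : transitive sorbit_le.
Proof.
move=> b a c; have [s as_] := sorbit_nonempty a.
have [t bt] := sorbit_nonempty b; have [u cu] := sorbit_nonempty c.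
move=> /(sorbit_leP as_ bt) st /(sorbit_leP bt cu) tu.
by apply/(sorbit_leP as_ cu); exact: is_face_trans st tu.
Qed.

Fact sorbit_display : Order.disp_t. Proof. exact: Order.Disp tt tt. Qed.

HB.instance Definition _ := Order.Le_isPOrder.Build sorbit_display sorbit
  sorbit_le_refl sorbit_le_anti sorbit_le_trans.

Definition simplex_aut p (alpha : cells X p.+1) : {set 'S_p.+1} :=
  [set rho | res X (inj_of_perm rho) alpha == alpha].

(** [restrict_along rho pi] is [rho^-1 \o pi \o rho]; it is a junk value when
    [pi] does not preserve the image of [rho]. *)
Definition restrict_along m n (rho : inj_ord m n) (pi : 'S_n) : 'S_m :=
  insubd (1%g : 'S_m) [ffun i => odflt i [pick j | rho j == pi (rho i)]].

Definition permissible_face p (alpha : cells X p.+1) (beta : cells X p.+2) :=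
  exists rho : inj_ord p.+1 p.+2,
  [/\ res X rho beta = alpha,
      forall theta theta' : inj_ord p.+1 p.+2,
        res X theta beta = alpha -> res X theta' beta = alpha ->
        range theta = range theta' &
      misom (simplex_aut beta) (simplex_aut alpha) (restrict_along rho)].

End Orbits.
Arguments mk_simplex {X p} x.

Section Matchings.
Context {d : Order.disp_t} {P : porderType d}.

Definition covered_by (a b : P) : Prop :=
  (a < b)%O /\ forall c : P, ~ ((a < c)%O /\ (c < b)%O).

Definition in_pair (x : P) (ab : P * P) : Prop := x = ab.1 \/ x = ab.2.

Definition matching (M : set (P * P)) : Prop :=
  (forall a b, M (a, b) -> covered_by a b) /\
  (forall x ab cd, M ab -> M cd -> in_pair x ab -> in_pair x cd -> ab = cd).

(** [ordS] is the cyclic successor, and [a i] is [d(b_i)]. *)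
Definition acyclic_matching (M : set (P * P)) : Prop :=
  ~ exists (n : nat) (a b : 'I_n -> P),
    [/\ (2 <= n)%N, injective b, forall i, M (a i, b i) &
        forall i, covered_by (a i) (b (ordS i))].

Definition matched (M : set (P * P)) (x : P) : Prop :=
  exists2 ab, M ab & in_pair x ab.

End Matchings.

Definition permissible_matching (X : sym_delta_complex)
    (M : set (sorbit X * sorbit X)) : Prop :=
  forall p (alpha : cells X p.+1) (beta : cells X p.+2),
    M (sorbit_of (mk_simplex alpha), sorbit_of (mk_simplex beta)) ->
    permissible_face alpha beta.

Section EquivClosure.
Context {T : Type} (r : T -> T -> Prop).

Definition equiv_closure (x y : T) : bool := `[< clos_refl_sym_trans T r x y >].

Lemma equiv_closure_refl : reflexive equiv_closure.
Proof. by move=> x; apply/asboolP; exact: rst_refl. Qed.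

Lemma equiv_closure_sym : symmetric equiv_closure.
Proof. by move=> x y; apply/asboolP/asboolP; exact: rst_sym. Qed.

Lemma equiv_closure_trans : transitive equiv_closure.
Proof.
by move=> y x z /asboolP xy /asboolP yz; apply/asboolP; exact: rst_trans xy yz.
Qed.

Canonical equiv_closure_equiv :=
  EquivRel equiv_closure equiv_closure_refl equiv_closure_sym
    equiv_closure_trans.

End EquivClosure.

Section Realization.
Variables (R : realType) (X : sym_delta_complex).

Definition std_simplex (p : nat) : set 'rV[R]_p.+1 :=
  [set a | (forall i, 0 <= a ord0 i) /\ \sum_i a ord0 i = 1].
Arguments std_simplex p _ : clear implicits.

(** [theta_*] sends the vertex [e_i] to [e_(theta i)]. *)
Definition push_row m n (theta : inj_ord m n) (a : 'rV[R]_m) : 'rV[R]_n :=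
  \row_j \sum_(i | theta i == j) a ord0 i.

Lemma push_row_simplex p q (theta : inj_ord p.+1 q.+1) (a : std_simplex p) :
  push_row theta (val a) \in std_simplex q.
Proof.
apply/mem_set; case: a => a /= /set_mem[a0 a1]; split=> [j|].
  by rewrite mxE sumr_ge0.
rewrite -[RHS]a1 [RHS](partition_big theta xpredT)//=.
by apply: eq_bigr => j _; rewrite mxE.
Qed.

Definition push p q (theta : inj_ord p.+1 q.+1) (a : std_simplex p) :
  std_simplex q := SigSub (push_row_simplex theta a).

Definition realization_pre : Type :=
  {p : nat & (discrete_topology (cells X p.+1) * std_simplex p)%type}.
HB.instance Definition _ := Topological.on realization_pre.

Definition mk_point p (x : cells X p.+1) (a : std_simplex p) :
  realization_pre := existT _ p (x, a).

Inductive glued : realization_pre -> realization_pre -> Prop :=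
| Glued p q (theta : inj_ord p.+1 q.+1) (x : cells X q.+1) (a : std_simplex p) :
    glued (mk_point x (push theta a)) (mk_point (res X theta x) a).

Definition realization : topologicalType :=
  quotient_topology {eq_quot (equiv_closure_equiv glued)}%qT.

End Realization.
Arguments std_simplex R p _ : clear implicits.

Section Homotopy.
Variable R : realType.

Definition homotopic (T U : topologicalType) (f g : T -> U) : Prop :=
  exists H : T * R -> U,
    [/\ {within [set: T] `*` `[0, 1], continuous H},
        forall x, H (x, 0) = f x & forall x, H (x, 1) = g x].

Definition homotopy_equivalent (T U : topologicalType) : Prop :=
  exists (f : T -> U) (g : U -> T),
    [/\ continuous f, continuous g, homotopic (g \o f) id &
        homotopic (f \o g) id].

End Homotopy.

Section Balls.
Variables (R : realType) (p : nat).

Record fin_orth_group := FinOrthGroup {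
  orth_carrier :> set 'M[R]_p;
  orth_finite : finite_set orth_carrier;
  orth_orth : forall A, orth_carrier A -> A^T *m A = 1%:M;
  orth1 : orth_carrier 1%:M;
  orthM : forall A B, orth_carrier A -> orth_carrier B -> orth_carrier (A *m B);
  orthV : forall A, orth_carrier A -> orth_carrier (invmx A)
}.

(** The library norm on ['cV[R]_p] is the sup norm, hence this explicit
    Euclidean norm; both induce the same topology. *)
Definition sqnorm (x : 'cV[R]_p) : R := \sum_i x i ord0 ^+ 2.

Definition unit_ball : set 'cV[R]_p := [set x | sqnorm x <= 1].

Variable G : fin_orth_group.

Definition ball_rel (x y : unit_ball) : bool :=
  `[< exists2 A, orth_carrier G A & val y = A *m val x >].

Lemma ball_rel_refl : reflexive ball_rel.
Proof. by move=> x; apply/asboolP; exists 1%:M; [exact: orth1|rewrite mul1mx]. Qed.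

Lemma ball_rel_sym : symmetric ball_rel.
Proof.
suff h x y : ball_rel x y -> ball_rel y x by move=> x y; apply/idP/idP; exact: h.
move=> /asboolP[A GA yE]; apply/asboolP; exists (invmx A); first exact: orthV.
by rewrite yE mulKmx//; have [] := mulmx1_unit (orth_orth GA).
Qed.

Lemma ball_rel_trans : transitive ball_rel.
Proof.
move=> y x z /asboolP[A GA yE] /asboolP[B GB zE]; apply/asboolP.
by exists (B *m A); [exact: orthM|rewrite zE yE mulmxA].
Qed.

Canonical ball_equiv :=
  EquivRel ball_rel ball_rel_refl ball_rel_sym ball_rel_trans.

Definition ball_quot : topologicalType :=
  quotient_topology {eq_quot ball_equiv}%qT.

Definition ball_pi (x : unit_ball) : ball_quot :=
  (\pi_(quotient_topology {eq_quot ball_equiv}) x)%qT.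

(** The quotient of the open ball, as a subspace of [ball_quot]; it has the same
    topology as the quotient of the open ball itself, which is open and
    [G]-stable. *)
Definition open_ball_quot : set ball_quot :=
  ball_pi @` [set x | sqnorm (val x) < 1].

Definition sphere_quot : set ball_quot :=
  ball_pi @` [set x | sqnorm (val x) = 1].

Definition group_isomorphic (gT : finGroupType) (H : {set gT}) : Prop :=
  exists2 f : gT -> 'M[R]_p, set_bij [set` H] G f &
    {in H &, forall s t, f (s * t)%g = f s *m f t}.

End Balls.
Arguments unit_ball R p _ : clear implicits.
Arguments open_ball_quot {R p} G _.
Arguments sphere_quot {R p} G _.

Definition locally_closed (T : topologicalType) (A : set T) : Prop :=
  exists U F, [/\ open U, closed F & A = U `&` F].

Definition maps_homeomorphically (T U : topologicalType) (f : T -> U)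
    (A : set T) (C : set U) : Prop :=
  [/\ set_bij A C f, {within A, continuous f} &
      exists2 g : U -> T, {within C, continuous g} &
        forall x, A x -> g (f x) = x].

(** The cells are nonempty and pairwise disjoint, so [cw_index] is in bijection
    with the set of cells. *)
Record symmetric_CW (R : realType) (Y : topologicalType) := SymmetricCW {
  cw_index : Type;
  cw_cell : cw_index -> set Y;
  cw_dim : cw_index -> nat;
  cw_group : forall i, fin_orth_group R (cw_dim i);
  cw_map : forall i, ball_quot (cw_group i) -> Y;
  cw_hausdorff : hausdorff_space Y;
  cw_partition : partition [set: cw_index] cw_cell [set: Y];
  cw_locally_closed : forall i, locally_closed (cw_cell i);
  cw_continuous : forall i, continuous (cw_map (i := i));
  cw_homeo : forall i, maps_homeomorphically (cw_map (i := i))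
    (open_ball_quot (cw_group i)) (cw_cell i);
  cw_boundary_finite : forall i, finite_set
    [set j | cw_cell j `&` (cw_map (i := i) @` sphere_quot (cw_group i))
             !=set0];
  cw_boundary_dim : forall i j,
    cw_cell j `&` (cw_map (i := i) @` sphere_quot (cw_group i)) !=set0 ->
    (cw_dim j < cw_dim i)%N;
  cw_closed : forall A : set Y,
    closed A <-> forall i, closed (A `&` closure (cw_cell i))
}.

(* Main.v *)
From Stdlib Require Import Relations.
Require Import Defs.
From mathcomp Require Import all_boot all_order all_fingroup all_algebra.
From mathcomp Require Import all_classical all_reals topology normedtype.
From mathcomp Require Import ring lra zify.
From mathcomp Require finmap.

(** Add the orbits one at a time, faces first, the two orbits of a matched pair
    together, which acyclicity allows.
    The free face of a matched pair is collapsed by pushing the top simplex away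
    from the vertex opposite to it; permissibility says exactly that points of the
    open pair which are identified in [|X|] differ by a symmetry fixing this vertex,
    so the push descends to [|X|].  The pushes do not leave the fibres of their end
    maps, and each of them extends to a homotopy of all of [|X|] which is constant on
    the earlier cells.  Hence the homotopies descend to the successive quotients of
    [|X|] by the collapses performed so far, and each quotient map is a homotopy
    equivalence.  In the last quotient every point has a unique representative in
    an open critical cell, and collapsing never raises the dimension of a carrier, so
    the images of the critical simplices form a symmetric CW structure; a simplex
    is a ball, equivariantly for its symmetry group. *)

(** The CW complex is not assembled by attaching cells: it is found as a quotient of [|X|] itself,
    so no attaching map has to be deformed and only closed equivalence relations on one compact
    Hausdorff space have to be controlled. Such a relation has a Hausdorff quotient, and finiteness
    of [X] lets continuity be tested on finitely many closed pieces. Each relation is given by the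
    fibres of an idempotent map [f]; this map may jump where a cell not yet added meets collapsed
    boundary points, so it serves to name representatives and never as a continuous map. The other
    obstacle is that a simplex may be glued to itself by its automorphisms. Maps on [|X|] are
    therefore defined on the coordinate vectors of a chosen representative and must commute with the
    relevant permutations. This dictates the barycenter as centre of the radial retraction, the
    single privileged vertex of the push, and a map from the ball to the simplex written only with
    permutation invariants. *)

Set Implicit Arguments.
Unset Strict Implicit.
Unset Printing Implicit Defensive.

Import Order.TTheory GRing.Theory Num.Theory.
Import numFieldNormedType.Exports.

Local Open Scope classical_set_scope.
Local Open Scope ring_scope.

(* [ssrfun] has lemmas with these names. *)
Local Notation inj_comp := Defs.inj_comp.
Local Notation inj_id := Defs.inj_id.

(** * Continuity on closed sets, quotients and homotopies *)

Section ClosedContinuity.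

(* On a closed set this is [{within A, continuous f}] (see [ccontP]); unlike the
   latter it makes restriction, pasting and composition purely set-theoretic. *)
Definition ccont (S T : topologicalType) (A : set S) (f : S -> T) :=
  forall D, closed D -> closed (A `&` f @^-1` D).

Lemma ccontP (S T : topologicalType) (A : set S) (f : S -> T) : closed A ->
  {within A, continuous f} <-> ccont A f.
Proof.
move=> cA; split.
  move=> /continuous_closedP fc D /fc /closed_subspaceP[V cV VE].
  by rewrite setIC -VE; exact: closedI.
move=> fc; apply/continuous_closedP => D cD; apply/closed_subspaceP.
exists (A `&` f @^-1` D); first exact: fc. by rewrite setIAC setIid; exact: setIC.
Qed.

Lemma ccontT (S T : topologicalType) (f : S -> T) :
  continuous f <-> ccont [set: S] f.
Proof.
split=> [/continuous_closedP fc D /fc|fc]; first by rewrite setTI.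
by apply/continuous_closedP => D /fc; rewrite setTI.
Qed.

Lemma continuous_ccont (S T : topologicalType) (A : set S) (f : S -> T) :
  closed A -> continuous f -> ccont A f.
Proof. by move=> cA /continuous_closedP fc D /fc; exact: closedI. Qed.

Lemma ccontS (S T : topologicalType) (A B : set S) (f : S -> T) :
  closed A -> A `<=` B -> ccont B f -> ccont A f.
Proof.
move=> cA AB fc D cD.
rewrite (_ : _ `&` _ = A `&` (B `&` f @^-1` D)); first by apply: closedI => //; exact: fc.
by apply/seteqP; split=> x [Ax]; [move=> Dx; split=> //; split=> //; exact: AB|case].
Qed.

Lemma ccont_eq (S T : topologicalType) (A : set S) (f g : S -> T) :
  {in A, f =1 g} -> ccont A f -> ccont A g.
Proof.
move=> fg fc D cD; rewrite (_ : _ `&` _ = A `&` f @^-1` D); first exact: fc.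
by apply/seteqP; split=> x [Ax]; rewrite /preimage /= fg// inE.
Qed.

Lemma ccontU (S T : topologicalType) (A B : set S) (f : S -> T) :
  ccont A f -> ccont B f -> ccont (A `|` B) f.
Proof. by move=> fA fB D cD; rewrite setIUl; apply: closedU; [exact: fA|exact: fB]. Qed.

Lemma ccont_comp (S T U : topologicalType) (A : set S) (B : set T)
    (f : S -> T) (g : T -> U) :
  A `<=` f @^-1` B -> ccont A f -> ccont B g -> ccont A (g \o f).
Proof.
move=> fAB fc gc D cD.
rewrite (_ : _ `&` _ = A `&` f @^-1` (B `&` g @^-1` D)); first by apply: fc; exact: gc.
by apply/seteqP; split=> x [Ax]; [move=> Dx; split=> //; split=> //; exact: fAB|case].
Qed.

Lemma compact_ccont_image (S T : topologicalType) (A : set S) (f : S -> T) :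
  compact A -> closed A -> ccont A f -> compact (f @` A).
Proof. by move=> cA clA fc; apply: continuous_compact => //; exact/ccontP. Qed.

(* A map from a compact set onto its image in a Hausdorff space is closed, hence
   a quotient map. *)
Lemma ccont_image (S T U : topologicalType) (A : set S) (q : S -> T)
    (f : T -> U) : hausdorff_space T -> compact A -> closed A -> ccont A q ->
  ccont A (f \o q) -> ccont (q @` A) f.
Proof.
move=> hT cA clA qc fqc D cD.
rewrite (_ : _ `&` _ = q @` (A `&` (f \o q) @^-1` D)).
  apply: compact_closed => //; apply: compact_ccont_image.
  - by apply: subclosed_compact cA _; [exact: fqc|move=> x []].
  - exact: fqc.
  - by apply: ccontS qc; [exact: fqc|move=> x []].
apply/seteqP; split=> [_ [[x Ax <-] fD]|_ [x [Ax fD] <-]]; first by exists x.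
by split=> //; exists x.
Qed.

Lemma ccont_pair (S T U : topologicalType) (A : set S) (f : S -> T)
    (g : S -> U) : closed A ->
  ccont A f -> ccont A g -> ccont A (fun x => (f x, g x)).
Proof.
move=> cA /(ccontP _ cA) fc /(ccontP _ cA) gc; apply/(ccontP _ cA) => x.
by apply: cvg_pair; [exact: fc|exact: gc].
Qed.

End ClosedContinuity.

Lemma continuous_pair (S T U : topologicalType) (f : S -> T) (g : S -> U) :
  continuous f -> continuous g -> continuous (fun x => (f x, g x)).
Proof. by move=> fc gc x; apply: cvg_pair; [exact: fc|exact: gc]. Qed.

Section ProductTopology.
Variables S T : topologicalType.

Lemma hausdorff_prod :
  hausdorff_space S -> hausdorff_space T -> hausdorff_space (S * T)%type.
Proof.
move=> hS hT [s t] [s' t'] cl; congr pair.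
  apply: hS => U V sU s'V.
  have [||[a b] [/= [aU _] [aV _]]] := cl (U `*` setT) (V `*` setT).
  - by exists (U, setT) => //=; split=> //; exact: filterT.
  - by exists (V, setT) => //=; split=> //; exact: filterT.
  by exists a.
apply: hT => U V sU s'V.
have [||[a b] [/= [_ aU] [_ aV]]] := cl (setT `*` U) (setT `*` V).
- by exists (setT, U) => //=; split=> //; exact: filterT.
- by exists (setT, V) => //=; split=> //; exact: filterT.
by exists b.
Qed.

Lemma closed_setX (A : set S) (B : set T) :
  closed A -> closed B -> closed (A `*` B).
Proof.
move=> cA cB; rewrite (_ : A `*` B = fst @^-1` A `&` snd @^-1` B); last first.
  by apply/seteqP; split.
apply: closedI; last first.
  by move: B cB {A cA}; apply/continuous_closedP => x; exact: cvg_snd.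
by move: A cA {B cB}; apply/continuous_closedP => x; exact: cvg_fst.
Qed.

Lemma closed_diag : hausdorff_space S -> closed [set p : S * S | p.1 = p.2].
Proof.
move=> hS [x y] cl /=; apply: hS => U V xU yV.
have [] := cl (U `*` V); first by exists (U, V).
by move=> [a b] [/= ab [/= aU bV]]; exists a; split=> //; rewrite ab.
Qed.

End ProductTopology.

(** * Quotients of compact Hausdorff spaces by closed relations *)

Section Quotients.
Context {T : topologicalType}.
Implicit Types e : equiv_rel T.

Definition quo e : topologicalType := quotient_topology {eq_quot e}%qT.
Definition proj e (x : T) : quo e := (\pi_(quotient_topology {eq_quot e}) x)%qT.

Lemma projP e x y : proj e x = proj e y <-> e x y.
Proof. by split=> [/eqmodP|exy]; last exact/eqmodP. Qed.

Lemma proj_surj e y : exists x, proj e x = y.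
Proof. by exists (generic_quotient.repr y); exact: reprK. Qed.

Lemma proj_repr e x : e (generic_quotient.repr (proj e x)) x.
Proof. by apply/projP; exact: reprK. Qed.

Lemma proj_continuous e : continuous (proj e).
Proof. exact: pi_continuous. Qed.

Lemma quo_continuous e (S : topologicalType) (f : quo e -> S) :
  continuous (f \o proj e) -> continuous f.
Proof. by move=> /quotient_continuous. Qed.

Lemma closed_quo e (C : set (quo e)) : closed (proj e @^-1` C) -> closed C.
Proof. by rewrite -!openC. Qed.

Hypothesis hT : hausdorff_space T.
Hypothesis cT : compact [set: T].

(** The saturation of a closed set is the projection of a closed subset of the compact [T * T], so
    [proj e] is a closed map; normality of [T] then separates two fibres. *)
Lemma quo_hausdorff e : closed [set p : T * T | e p.1 p.2] ->
  hausdorff_space (quo e).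
Proof.
move=> ce; have closed_proj A : closed A -> closed (proj e @^-1` (proj e @` A)).
  move=> cA; rewrite (_ : _ @^-1` _ =
      snd @` ([set p : T * T | e p.1 p.2] `&` (A `*` setT))).
    apply: compact_closed => //; apply: continuous_compact.
      by apply: continuous_subspaceT => x; exact: cvg_snd.
    apply: subclosed_compact (compact_setX cT cT) _; last by move=> ?.
    by apply: closedI => //; exact: closed_setX.
  apply/seteqP; split=> [y [x Ax /projP xy]|_ [[x y] [/= xy [/= Ax _]] <-]].
    by exists (x, y).
  by exists x => //; exact/projP.
rewrite open_hausdorff => y1 y2 y12.
have [x1 yE1] := proj_surj y1; have [x2 yE2] := proj_surj y2.
have fiberE x : proj e @^-1` [set proj e x] = proj e @^-1` (proj e @` [set x]).
  by rewrite image_set1.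
have closed1 (x : T) : closed [set x].
  by apply: compact_closed => //; exact: compact_set1.
have cF x : closed (proj e @^-1` [set proj e x]).
  by rewrite fiberE; exact: closed_proj.
have /(compact_normal hT cT (cF x1)) [B nB clB] :
    set_nbhs (proj e @^-1` [set proj e x1]) (~` (proj e @^-1` [set proj e x2])).
  apply/set_nbhsP; exists (~` (proj e @^-1` [set proj e x2])); split=> //.
    by rewrite openC.
  move=> z /= zx1 zx2; move/eqP: y12; apply.
  by rewrite -yE1 -yE2 -zx1 -zx2.
move/set_nbhsP: nB => [U [oU FU UB]].
(* [U] contains the first fibre and lies in [B], whose closure misses the second. Removing the
   images of the complement of [U] and of [closure B] leaves disjoint open sets around the two
   points. *)
exists (~` (proj e @` (~` U)), ~` (proj e @` closure B)).
  split; rewrite inE -?yE1 -?yE2 => -[z zU zE]; first by apply: zU; exact: FU.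
  exact: (clB z zU zE).
split=> /=.
- by rewrite openC; exact: closed_quo (closed_proj _ (open_closedC oU)).
- by rewrite openC; exact: closed_quo (closed_proj _ (@closed_closure _ B)).
apply/eqP/seteqP; split=> // y [/= yU yB]; have [x xE] := proj_surj y.
have [xU|xU] := pselect (U x); last by apply: yU; exists x.
by apply: yB; exists x => //; exact/subset_closure/UB.
Qed.

End Quotients.

Section Homotopies.
Variable R : realType.
Local Notation I := (`[0, 1]%classic : set R).
Implicit Types S T U V : topologicalType.

Lemma closed_cylinder T (a b : R) : closed ([set: T] `*` `[a, b]).
Proof. by apply: closed_setX; [exact: closedT|exact: interval_closed]. Qed.

Lemma homotopicE T U (f g : T -> U) : homotopic R f g <->
  exists H : T * R -> U, [/\ ccont ([set: T] `*` I) H,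
    forall x, H (x, 0) = f x & forall x, H (x, 1) = g x].
Proof.
have cyl := @closed_cylinder T 0 1.
split=> -[H [Hc H0 H1]]; exists H; split=> //; first by move/(ccontP _ cyl): Hc.
exact/(ccontP _ cyl).
Qed.

Lemma homotopic_refl T U (f : T -> U) : continuous f -> homotopic R f f.
Proof.
move=> fc; apply/homotopicE; exists (f \o fst); split=> //.
apply: continuous_ccont; first exact: closed_cylinder.
by move=> x; apply: continuous_comp; [exact: cvg_fst|exact: fc].
Qed.

Lemma ccont_reparam T U (H : T * R -> U) (a b c d : R) :
  (forall t, a <= t <= b -> 0 <= c * t + d <= 1) -> ccont ([set: T] `*` I) H ->
  ccont ([set: T] `*` `[a, b]) (fun p => H (p.1, c * p.2 + d)).
Proof.
move=> abI Hc; have cyl := @closed_cylinder T a b.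
apply: (@ccont_comp _ _ _ _ ([set: T] `*` I) (fun p => (p.1, c * p.2 + d)) H) => //.
  by move=> [x t] [_ /=]; rewrite in_itv/= => /abI tI; split=> //=; rewrite in_itv.
apply: continuous_ccont => //; apply: continuous_pair => p; first exact: cvg_fst.
apply: (@cvgD _ R^o); last exact: cvg_cst.
by apply: (@cvgM R); [exact: cvg_cst|exact: cvg_snd].
Qed.

Lemma homotopic_sym T U (f g : T -> U) : homotopic R f g -> homotopic R g f.
Proof.
move=> /homotopicE[H [Hc H0 H1]]; apply/homotopicE.
exists (fun p => H (p.1, -1 * p.2 + 1)); split=> [|x|x] /=.
- by apply: ccont_reparam => // t tI; lra.
- by rewrite mulr0 add0r.
- by rewrite mulr1 addNr.
Qed.

Lemma homotopic_trans T U (f g h : T -> U) :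
  homotopic R f g -> homotopic R g h -> homotopic R f h.
Proof.
move=> /homotopicE[H [Hc H0 H1]] /homotopicE[K [Kc K0 K1]]; apply/homotopicE.
exists (fun p => if p.2 <= 2^-1 then H (p.1, 2 * p.2 + 0)
                 else K (p.1, 2 * p.2 + -1)).
split=> [|x|x] /=; last 2 first.
- by rewrite invr_ge0 ler0n mulr0 addr0.
- rewrite ifF; last by apply/negbTE; rewrite -ltNge; lra.
  by rewrite -[RHS]K1; congr (K (_, _)); ring.
rewrite (_ : _ `*` _ = ([set: T] `*` `[0, 2^-1]) `|` ([set: T] `*` `[2^-1, 1])).
  apply: ccontU.
    apply: ccont_eq (ccont_reparam (c := 2) (d := 0) _ Hc).
      by move=> [x t]; rewrite inE /= in_itv/= => -[_ /andP[_ ->]].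
    by move=> t tI; lra.
  apply: ccont_eq (ccont_reparam (c := 2) (d := -1) _ Kc).
    move=> [x t]; rewrite inE /= in_itv/= => -[_ /andP[t2 _]].
    case: ifPn => // t2'; have -> : t = 2^-1 by apply/le_anti; rewrite t2 t2'.
    have h1 : 2 / 2 - 1 = 0 :> R by lra.
    have h2 : 2 / 2 + 0 = 1 :> R by lra.
    by rewrite [X in K X](_ : _ = (x, 0)) ?[X in H X](_ : _ = (x, 1)) ?H1 ?K0//;
      congr pair.
  by move=> t tI; lra.
apply/seteqP; split=> [[x t] [_ /=]|[x t] [] [_ /=]]; rewrite !in_itv/= => tI.
- by have [t2|t2] := leP t 2^-1; [left|right]; split=> //; lra.
- by split=> //; lra.
- by split=> //; lra.
Qed.

Lemma homotopic_compl T U V (f g : T -> U) (h : U -> V) :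
  continuous h -> homotopic R f g -> homotopic R (h \o f) (h \o g).
Proof.
move=> /ccontT hc /homotopicE[H [Hc H0 H1]]; apply/homotopicE.
exists (h \o H); split=> [|x|x] /=; rewrite ?H0 ?H1//.
exact: ccont_comp Hc hc.
Qed.

Lemma homotopic_compr S T U (f g : T -> U) (k : S -> T) :
  continuous k -> homotopic R f g -> homotopic R (f \o k) (g \o k).
Proof.
move=> kc /homotopicE[H [Hc H0 H1]]; apply/homotopicE.
exists (fun p => H (k p.1, p.2)); split=> [|x|x] /=; rewrite ?H0 ?H1//.
apply: (@ccont_comp _ _ _ _ ([set: T] `*` I) (fun p => (k p.1, p.2)) H) => //.
apply: continuous_ccont; first exact: closed_cylinder.
apply: continuous_pair => p; last exact: cvg_snd.
by apply: continuous_comp; [exact: cvg_fst|exact: kc].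
Qed.

Lemma homotopy_equivalent_trans T U V : homotopy_equivalent R T U ->
  homotopy_equivalent R U V -> homotopy_equivalent R T V.
Proof.
move=> [f [g [fc gc gf fg]]] [h [k [hc kc kh hk]]].
exists (h \o f), (g \o k); split.
- by move=> x; apply: continuous_comp; [exact: fc|exact: hc].
- by move=> x; apply: continuous_comp; [exact: kc|exact: gc].
- apply: homotopic_trans gf.
  exact: (homotopic_compl gc (homotopic_compr fc kh)).
- apply: homotopic_trans hk.
  exact: (homotopic_compl hc (homotopic_compr kc fg)).
Qed.

(** * Homotopies that descend to quotients *)

Section QuotientEquivalence.
Context {T : topologicalType}.
Hypothesis hT : hausdorff_space T.
Hypothesis cT : compact [set: T].
Implicit Types e : equiv_rel T.

Let repr_of e : quo e -> T := @generic_quotient.repr T _.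

(** The cylinder over the quotient is the image of the compact cylinder over [T], so continuity may
    be tested upstairs, where the last hypothesis removes the choice of representative. *)
Lemma quo_ccont e (H : T * R -> T) : closed [set p : T * T | e p.1 p.2] ->
  ccont ([set: T] `*` I) H ->
  (forall x y t, 0 <= t <= 1 -> e x y -> e (H (x, t)) (H (y, t))) ->
  ccont ([set: quo e] `*` I)
    (fun p => proj e (H (@repr_of e p.1, p.2)) : quo e).
Proof.
move=> ce Hc He.
rewrite (_ : _ `*` _ = (fun p => (proj e p.1, p.2)) @` ([set: T] `*` I)).
  apply: ccont_image.
  - by apply: hausdorff_prod; [exact: quo_hausdorff|exact: Rhausdorff].
  - by apply: compact_setX => //; exact: segment_compact.
  - exact: closed_cylinder.
  - apply: continuous_ccont; first exact: closed_cylinder.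
    apply: continuous_pair => p; last exact: cvg_snd.
    by apply: continuous_comp; [exact: cvg_fst|exact: proj_continuous].
  apply: (@ccont_eq _ _ _ (proj e \o H)).
    move=> [x t]; rewrite inE /= in_itv/= => -[_ tI]; apply/projP.
    by apply: He => //; rewrite equiv_sym; exact: proj_repr.
  apply: (@ccont_comp _ _ _ _ setT H (proj e)) => //.
  by apply/ccontT; exact: proj_continuous.
apply/seteqP; split=> [[y t] [_ /= tI]|_ [[x t] [_ /= tI] <-]]; last by [].
by have [x <-] := proj_surj y; exists (x, t).
Qed.

(** The inverse of the quotient map from [quo e] to [quo e'] is induced by [H (_, 1)], which the
    last hypothesis makes well defined. Both composites are end maps of the homotopies that [H]
    induces on the two quotients. *)
Lemma quo_homotopy_equivalent e e' (H : T * R -> T) :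
  closed [set p : T * T | e p.1 p.2] -> closed [set p : T * T | e' p.1 p.2] ->
  (forall x y, e x y -> e' x y) ->
  ccont ([set: T] `*` I) H -> (forall x, H (x, 0) = x) ->
  (forall x y t, 0 <= t <= 1 -> e x y -> e (H (x, t)) (H (y, t))) ->
  (forall x y t, 0 <= t <= 1 -> e' x y -> e' (H (x, t)) (H (y, t))) ->
  (forall x y, e' x y -> e (H (x, 1)) (H (y, 1))) ->
  homotopy_equivalent R (quo e) (quo e').
Proof.
move=> ce ce' ee' Hc H0 He He' H1.
pose f (y : quo e) := proj e' (repr_of y).
pose g (y : quo e') := proj e (H (repr_of y, 1)).
have fE x : f (proj e x) = proj e' x by apply/projP/ee'/proj_repr.
have gE x : g (proj e' x) = proj e (H (x, 1)) by apply/projP/H1/proj_repr.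
have H1c : continuous (fun x => H (x, 1)).
  apply/ccontT; apply: (@ccont_comp _ _ _ _ ([set: T] `*` I) (fun x => (x, 1))) => //.
    by move=> x _; split=> //=; rewrite in_itv/= ler01 lexx.
  by apply/ccontT; apply: continuous_pair => x; [exact: cvg_id|exact: cvg_cst].
have repr_proj e1 (y : quo e1) : proj e1 (repr_of y) = y by exact: reprK.
exists f, g; split.
- apply: quo_continuous; rewrite (_ : _ \o _ = proj e'); last exact/funext.
  exact: proj_continuous.
- apply: quo_continuous.
  rewrite (_ : _ \o _ = proj e \o (fun x => H (x, 1))); last exact/funext.
  by move=> x; apply: continuous_comp; [exact: H1c|exact: proj_continuous].
- apply/homotopic_sym/homotopicE; exists (fun p => proj e (H (repr_of p.1, p.2))).
  split; first exact: quo_ccont.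
    by move=> y /=; rewrite H0 repr_proj.
  by move=> y /=; rewrite -gE -fE !repr_proj.
- apply/homotopic_sym/homotopicE; exists (fun p => proj e' (H (repr_of p.1, p.2))).
  split; first exact: quo_ccont.
    by move=> y /=; rewrite H0 repr_proj.
  by move=> y /=; rewrite -fE -gE repr_proj.
Qed.

(** The start of the chain of equivalences, before any collapse is made. *)
Lemma quo_eq_homotopy_equivalent e : (forall x y, e x y -> x = y) ->
  homotopy_equivalent R T (quo e).
Proof.
move=> ee; have reprE x : repr_of (proj e x) = x by exact/ee/proj_repr.
exists (proj e), (@repr_of e); split.
- exact: proj_continuous.
- apply: quo_continuous; rewrite (_ : _ \o _ = id); last exact/funext.
  by move=> x; exact: cvg_id.
- rewrite (_ : _ \o _ = id); last exact/funext.
  by apply: homotopic_refl => x; exact: cvg_id.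
rewrite (_ : _ \o _ = id); last by apply/funext => y; exact: reprK.
by apply: homotopic_refl => x; exact: cvg_id.
Qed.

End QuotientEquivalence.
End Homotopies.

(** * Standard simplices *)

Section RealContinuity.
Context {R : realType} {S : topologicalType}.
Implicit Types f g : S -> R.

Lemma rcontD f g :
  continuous f -> continuous g -> continuous (fun x => f x + g x).
Proof. by move=> fc gc x; apply: (@cvgD _ R^o); [exact: fc|exact: gc]. Qed.

Lemma rcontN f : continuous f -> continuous (fun x => - f x).
Proof. by move=> fc x; apply: (@cvgN _ R^o); exact: fc. Qed.

Lemma rcontM f g :
  continuous f -> continuous g -> continuous (fun x => f x * g x).
Proof. by move=> fc gc x; apply: (@cvgM R); [exact: fc|exact: gc]. Qed.

Lemma rcontV f : (forall x, f x != 0) -> continuous f ->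
  continuous (fun x => (f x)^-1).
Proof. by move=> f0 fc x; apply: (@cvgV R); [exact: f0|exact: fc]. Qed.

Lemma rcont_min f g :
  continuous f -> continuous g -> continuous (fun x => Num.min (f x) (g x)).
Proof. by move=> fc gc x; apply: continuous_min; [exact: fc|exact: gc]. Qed.

Lemma rcont_max f g :
  continuous f -> continuous g -> continuous (fun x => Num.max (f x) (g x)).
Proof. by move=> fc gc x; apply: continuous_max; [exact: fc|exact: gc]. Qed.

Lemma rcont_sum I (r : seq I) (P : pred I) (F : I -> S -> R) :
  (forall i, continuous (F i)) ->
  continuous (fun x => \sum_(i <- r | P i) F i x).
Proof.
move=> Fc; elim: r => [|i r IHr].
  rewrite (_ : (fun _ => _) = fun=> 0); last by apply/funext => x; rewrite big_nil.
  exact: cst_continuous.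
rewrite (_ : (fun _ => _) = fun x => (if P i then F i x else 0) +
    \sum_(i <- r | P i) F i x); last first.
  by apply/funext => x; rewrite big_cons; case: ifP; rewrite ?add0r.
by apply: rcontD => //; case: (P i); [exact: Fc|exact: cst_continuous].
Qed.

Lemma rcont_bigmin I (r : seq I) (P : pred I) (g : S -> R) (F : I -> S -> R) :
  continuous g -> (forall i, continuous (F i)) ->
  continuous (fun x => \big[Num.min/g x]_(i <- r | P i) F i x).
Proof.
move=> gc Fc; elim: r => [|i r IHr].
  by rewrite (_ : (fun _ => _) = g)//; apply/funext => x; rewrite big_nil.
case Pi : (P i); last first.
  rewrite (_ : (fun _ => _) = fun x => \big[Num.min/g x]_(i <- r | P i) F i x)//.
  by apply/funext => x; rewrite big_cons Pi.
rewrite (_ : (fun _ => _) = fun x => Num.min (F i x)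
    (\big[Num.min/g x]_(i <- r | P i) F i x)); last first.
  by apply/funext => x; rewrite big_cons Pi.
by apply: rcont_min => //; exact: Fc.
Qed.

Lemma rV_continuous n (f : S -> 'rV[R]_n) :
  (forall j, continuous (fun x => f x ord0 j)) -> continuous f.
Proof.
move=> fc x A [P Px PA]; have : \forall y \near x, forall j, P ord0 j (f y ord0 j).
  by apply: filter_forall => j; apply: fc; exact: Px.
by apply: filterS => y Py; apply: PA => i j; rewrite ord1.
Qed.

Lemma cV_continuous n (f : S -> 'cV[R]_n) :
  (forall j, continuous (fun x => f x j ord0)) -> continuous f.
Proof.
move=> fc x A [P Px PA]; have : \forall y \near x, forall j, P j ord0 (f y j ord0).
  by apply: filter_forall => j; apply: fc; exact: Px.
by apply: filterS => y Py; apply: PA => i j; rewrite ord1.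
Qed.

Lemma closed_eq_fun f g :
  continuous f -> continuous g -> closed [set x | f x = g x].
Proof.
move=> fc gc; rewrite (_ : [set _ | _] = (fun x => f x - g x) @^-1` [set 0]).
  apply: preimage_closed; last first.
    by apply: compact_closed; [exact: Rhausdorff|exact: compact_set1].
  by move=> x _; apply: rcontD => //; exact: rcontN.
by apply/seteqP; split=> x /= => [->|/eqP]; rewrite ?subrr ?subr_eq0// => /eqP.
Qed.

Lemma closed_le_fun f g :
  continuous f -> continuous g -> closed [set x | f x <= g x].
Proof.
move=> fc gc; rewrite (_ : [set _ | _] = (fun x => g x - f x) @^-1` [set y | 0 <= y]).
  apply: preimage_closed; last exact: closed_ge.
  by move=> x _; apply: rcontD => //; exact: rcontN.
by apply/seteqP; split=> x /=; rewrite subr_ge0.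
Qed.

End RealContinuity.

Lemma hausdorff_injective (S T : topologicalType) (f : S -> T) :
  continuous f -> injective f -> hausdorff_space T -> hausdorff_space S.
Proof.
move=> fc finj hT x y xy; apply/finj/hT => U V Ux Vy.
by have [z [Uz Vz]] := xy _ _ (fc x U Ux) (fc y V Vy); exists (f z).
Qed.

Lemma set_type_hausdorff (T : topologicalType) (A : set T) :
  hausdorff_space T -> hausdorff_space A.
Proof.
apply: (@hausdorff_injective _ _ (set_val : A -> T)).
  exact: (@initial_continuous A T set_val).
by move=> x y /val_inj.
Qed.

Section StandardSimplex.
Variable R : realType.
Local Notation simp p := (std_simplex R p).

Definition positive n (a : 'rV[R]_n) := forall i, 0 < a ord0 i.

Section PushRow.
Context {m n : nat}.
Implicit Types (theta : inj_ord m n) (a : 'rV[R]_m).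

Lemma push_rowE theta a i : push_row theta a ord0 (theta i) = a ord0 i.
Proof.
rewrite mxE (bigD1 i)//= big1 ?addr0// => j /andP[/eqP/inj_inj -> /eqP].
by [].
Qed.

Lemma push_row0 theta a j : ~ range theta j -> push_row theta a ord0 j = 0.
Proof.
move=> jn; rewrite mxE big1// => i /eqP ij.
by exfalso; apply: jn; exists i.
Qed.

Lemma push_rowP theta a (b : 'rV[R]_n) :
  (forall i, b ord0 (theta i) = a ord0 i) ->
  (forall j, ~ range theta j -> b ord0 j = 0) -> b = push_row theta a.
Proof.
move=> bE b0; apply/rowP => j.
have [[i _ <-]|jn] := pselect (range theta j); first by rewrite push_rowE.
by rewrite push_row0// b0.
Qed.

Lemma push_row_inj theta : injective (@push_row R _ _ theta).
Proof. by move=> a b ab; apply/rowP => i; rewrite -!(push_rowE theta) ab. Qed.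

Lemma push_row_sum theta a :
  \sum_j push_row theta a ord0 j = \sum_i a ord0 i.
Proof.
rewrite [RHS](partition_big theta xpredT)//=.
by apply: eq_bigr => j _; rewrite mxE.
Qed.

Lemma push_row_range theta a j :
  0 < push_row theta a ord0 j -> range theta j.
Proof.
move=> aj; apply: contrapT => /(push_row0 a) j0.
by rewrite j0 ltxx in aj.
Qed.

End PushRow.

Lemma inj_compE l m n (g : inj_ord m n) (f : inj_ord l m) i :
  inj_comp g f i = g (f i).
Proof. by rewrite {1}/inj_fun /= ffunE. Qed.

Lemma inj_idE n i : inj_id n i = i.
Proof. by rewrite /inj_fun /= ffunE. Qed.

Lemma push_row_comp l m n (g : inj_ord m n) (f : inj_ord l m) (a : 'rV[R]_l) :
  push_row (inj_comp g f) a = push_row g (push_row f a).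
Proof.
apply/esym/push_rowP => [i|j jn]; first by rewrite inj_compE !push_rowE.
have [[k _ kj]|?] := pselect (range g j); last by rewrite push_row0.
rewrite -kj push_rowE push_row0// => -[i _ ik]; apply: jn.
by exists i => //; rewrite inj_compE ik.
Qed.

Lemma push_row_id n (a : 'rV[R]_n) : push_row (inj_id n) a = a.
Proof.
by apply/esym/push_rowP => [i|j []]; [rewrite inj_idE|exists j => //; rewrite inj_idE].
Qed.

Lemma push_row_in p q (theta : inj_ord p.+1 q.+1) a :
  simp p a -> simp q (push_row theta a).
Proof.
move=> [a0 a1]; split; last by rewrite push_row_sum.
by move=> j; rewrite mxE sumr_ge0.
Qed.

Lemma push_row_continuous m n (theta : inj_ord m n) :
  continuous (@push_row R _ _ theta).
Proof.
apply: rV_continuous => j; rewrite (_ : (fun _ => _) =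
    fun x : 'rV[R]_m => \sum_(i | theta i == j) x ord0 i).
  by apply: rcont_sum => i; exact: coord_continuous.
by apply/funext => x; rewrite mxE.
Qed.

Lemma inj_factor l m n (g : inj_ord m n) (f : inj_ord l n) :
  range f `<=` range g -> exists h, f = inj_comp g h.
Proof.
move=> fg; have /choice[h hE] : forall i, exists j, g j = f i.
  by move=> i; have [j _ jE] := fg (f i) (ex_intro2 _ _ i I erefl); exists j.
have hI : injectiveb (finfun h).
  apply/injectiveP => i j; rewrite !ffunE => hij.
  by apply: (@inj_inj _ _ f); rewrite -!hE hij.
exists (mk_inj hI); apply: inj_ext => i; rewrite inj_compE -hE.
by rewrite [mk_inj hI i]/inj_fun /= ffunE.
Qed.

(** The face is spanned by the positive coordinates. This interior form of a point is what equality
    in the realization is reduced to. *)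
Lemma simp_support p a : simp p a -> exists m (c : 'rV[R]_m.+1)
  (theta : inj_ord m.+1 p.+1), [/\ simp m c, positive c & a = push_row theta c].
Proof.
move=> [a0 a1]; pose A := [set i | 0 < a ord0 i]%SET.
have [i0 Ai0] : exists i, i \in A.
  apply: contrapT => noA; move: a1; rewrite big1 => [/eqP|i _].
    by rewrite eq_sym oner_eq0.
  apply/eqP; rewrite eq_le a0 andbT leNgt; apply/negP => ai.
  by apply: noA; exists i; rewrite inE.
have cA : #|A|.-1.+1 = #|A| by rewrite prednK// (cardD1 i0) Ai0.
pose f i := enum_val (cast_ord cA i).
have fI : injectiveb (finfun f).
  by apply/injectiveP => i j; rewrite !ffunE => /enum_val_inj/cast_ord_inj.
pose theta : inj_ord #|A|.-1.+1 p.+1 := mk_inj fI.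
have thetaE i : theta i = f i by rewrite /inj_fun/= ffunE.
pose c : 'rV[R]_#|A|.-1.+1 := \row_i a ord0 (theta i).
have cp : positive c.
  by move=> i; rewrite mxE thetaE; have := enum_valP (cast_ord cA i); rewrite inE.
have ac : a = push_row theta c.
  apply: push_rowP => [i|j jn]; first by rewrite mxE.
  apply/eqP; rewrite eq_le a0 andbT leNgt; apply/negP => aj; apply: jn.
  have jA : j \in A by rewrite inE.
  exists (cast_ord (esym cA) (enum_rank_in jA j)) => //.
  by rewrite thetaE /f cast_ordKV enum_rankK_in.
exists #|A|.-1, c, theta; split=> //; split=> [i|]; first exact: ltW.
by rewrite -(push_row_sum theta) -ac.
Qed.

Lemma simp_closed p : closed (simp p).
Proof.
rewrite (_ : simp p = \bigcap_i [set a : 'rV[R]_p.+1 | 0 <= a ord0 i] `&`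
    [set a : 'rV[R]_p.+1 | \sum_i a ord0 i = 1]); last first.
  apply/seteqP; split=> a [a0 a1]; split=> //; first by move=> i _; exact: a0.
  by move=> i; exact: a0.
apply: closedI.
  apply: closed_bigI => i _; apply: closed_le_fun; first exact: cst_continuous.
  exact: coord_continuous.
apply: closed_eq_fun; last exact: cst_continuous.
by apply: rcont_sum => i; exact: coord_continuous.
Qed.

Lemma simp_le1 p a i : simp p a -> a ord0 i <= 1.
Proof.
by move=> [a0 <-]; rewrite (bigD1 i)//= lerDl sumr_ge0.
Qed.

Lemma simp_compact p : compact (simp p).
Proof.
apply: (subclosed_compact (@simp_closed p)
    (@rV_compact R p.+1 (fun=> `[0, 1]%classic) _)) => [i|a ap i].
  exact: segment_compact.
by rewrite /= in_itv/= (simp_le1 i ap); case: ap => ->.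
Qed.

Definition barycenter p : 'rV[R]_p.+1 := const_mx p.+1%:R^-1.

Lemma barycenter_in p : simp p (barycenter p).
Proof.
split=> [i|]; first by rewrite mxE invr_ge0.
under eq_bigr do rewrite mxE.
by rewrite sumr_const card_ord -[_ *+ _]mulr_natl divff// pnatr_eq0.
Qed.

End StandardSimplex.
Arguments positive {R n}.

(** * Characteristic maps of the realization *)

Section OrbitDimension.
Variable X : sym_delta_complex.
Implicit Types (s t : simplex X) (o : sorbit X).

Lemma sorbit_ofP s t :
  (sorbit_of s <= sorbit_of t)%O <-> is_face s t.
Proof. by apply: sorbit_leP; exact: orbit_set_refl. Qed.

Lemma sorbit_of_eq s t : is_face s t -> is_face t s ->
  sorbit_of s = sorbit_of t.
Proof.
by move=> st ts; apply/le_anti/andP; split; apply/sorbit_ofP.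
Qed.

Lemma sorbit_of_surj o : exists s, sorbit_of s = o.
Proof.
have [s os] := sorbit_nonempty o; exists s; apply: val_inj.
by rewrite (sorbit_valP os).
Qed.

Definition orep o : simplex X := sval (cid (sorbit_of_surj o)).

Lemma orepK o : sorbit_of (orep o) = o.
Proof. exact: (svalP (cid (sorbit_of_surj o))). Qed.

Definition odim o : nat := tag (orep o).

Lemma odim_of s : odim (sorbit_of s) = tag s.
Proof.
have := orepK (sorbit_of s); rewrite /odim; move: (orep _) => t ts.
apply/anti_leq/andP; split; apply: is_face_dim; apply/sorbit_ofP; by rewrite ts.
Qed.

Lemma odim_le o o' : (o <= o')%O -> (odim o <= odim o')%N.
Proof.
by rewrite -(orepK o) -(orepK o') => /sorbit_ofP/is_face_dim; rewrite !odim_of.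
Qed.

(** A face of equal dimension is glued by a permutation, so it lies in the same orbit. *)
Lemma odim_lt o o' : (o < o')%O -> (odim o < odim o')%N.
Proof.
rewrite lt_def => /andP[/eqP oo' /[dup] le_oo' /odim_le].
rewrite leq_eqVlt => /predU1P[oE|//]; exfalso; apply: oo'.
move: le_oo' oE; rewrite -(orepK o) -(orepK o') !odim_of => /sorbit_ofP st E.
apply: val_inj => /=; apply: orbit_set_eq; apply/orbit_setP.
by split.
Qed.

End OrbitDimension.

(** * Points of the realization in coordinates, and their carriers *)

Section Characteristic.
Variables (R : realType) (X : sym_delta_complex).
Local Notation simp p := (std_simplex R p).
Local Notation T := (realization R X).

Definition base_point p : simp p := SigSub (mem_set (barycenter_in R p)).

(* Points of the realization are named by coordinate vectors in the ambient
   space; vectors outside the simplex are sent to the barycenter. *)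
Definition rep_point p (x : cells X p.+1) (a : 'rV[R]_p.+1) :
  realization_pre R X := mk_point x (insubd (base_point p) a).

Definition chi p (x : cells X p.+1) (a : 'rV[R]_p.+1) : T :=
  proj (equiv_closure_equiv (@glued R X)) (rep_point x a).

Lemma rep_pointE p (x : cells X p.+1) (a : simp p) :
  rep_point x (val a) = mk_point x a.
Proof. by congr mk_point; exact: valKd. Qed.

Lemma rep_point_surj (u : realization_pre R X) :
  exists p (x : cells X p.+1) a, simp p a /\ u = rep_point x a.
Proof.
case: u => p [x a]; exists p, x, (val a); split; last by rewrite rep_pointE.
by case: a => a /= /set_mem.
Qed.

Lemma chi_push p q (x : cells X q.+1) (theta : inj_ord p.+1 q.+1) a :
  simp p a -> chi x (push_row theta a) = chi (res X theta x) a.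
Proof.
move=> ap; apply/projP/asboolP; apply: rst_step.
have := Glued theta x (SigSub (mem_set ap)).
by rewrite -!rep_pointE.
Qed.

(** An explicit form of the equivalence relation generated by gluing, see [chiP]. Requiring [c] to
    be interior is what makes it transitive. *)
Definition common_face p q (x : cells X p.+1) (a : 'rV[R]_p.+1)
    (y : cells X q.+1) (b : 'rV[R]_q.+1) : Prop :=
  exists m (c : 'rV[R]_m.+1) (theta : inj_ord m.+1 p.+1)
    (theta' : inj_ord m.+1 q.+1), [/\ simp m c /\ positive c,
      res X theta x = res X theta' y, a = push_row theta c &
      b = push_row theta' c].

Lemma common_face_refl p (x : cells X p.+1) a : simp p a ->
  common_face x a x a.
Proof.
by move=> /simp_support[m [c [theta [mc c0 aE]]]]; exists m, c, theta, theta.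
Qed.

Lemma common_face_sym p q (x : cells X p.+1) a (y : cells X q.+1) b :
  common_face x a y b -> common_face y b x a.
Proof. by move=> [m [c [t [t' [mc xy aE bE]]]]]; exists m, c, t', t. Qed.

Lemma common_face_trans p q r (x : cells X p.+1) a (y : cells X q.+1) b
    (z : cells X r.+1) d :
  common_face x a y b -> common_face y b z d -> common_face x a z d.
Proof.
move=> [m [c [t [t' [mc xy aE bE]]]]] [m2 [c2 [u [u' [mc2 yz bE2 dE]]]]].
(* Each vertex in the image of [u] carries a positive coordinate of [b], hence lies in the image of
   [t']. *)
have [h uE] : exists h, u = inj_comp t' h.
  apply: inj_factor => _ [i _ <-]; apply: (@push_row_range R _ _ t' c).
  by rewrite -bE bE2 push_rowE; case: mc2.
have cE : c = push_row h c2.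
  by apply: (@push_row_inj _ _ _ t'); rewrite -push_row_comp -uE -bE.
exists m2, c2, (inj_comp t h), u'; split=> //.
  by rewrite res_comp xy -res_comp -uE.
by rewrite push_row_comp -cE.
Qed.

Lemma chiP p q (x : cells X p.+1) a (y : cells X q.+1) b :
  simp p a -> simp q b -> chi x a = chi y b <-> common_face x a y b.
Proof.
move=> pa qb; split; last first.
  by move=> [m [c [t [t' [[mc _] xy -> ->]]]]]; rewrite !chi_push// xy.
(* The relation is restated on whole points of the disjoint union, so that induction on the
   generated equivalence can run through simplices of varying dimension. *)
pose cf (u v : realization_pre R X) :=
  common_face (tagged u).1 (val (tagged u).2) (tagged v).1 (val (tagged v).2).
have simp_val (u : realization_pre R X) : simp (tag u) (val (tagged u).2).
  by case: u => n [z [d /= /set_mem]].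
move=> /projP/asboolP xy; suff: cf (rep_point x a) (rep_point y b).
  by rewrite /cf /= !insubdK//; exact: mem_set.
elim: xy => {p q x a y b pa qb} [u v []|u|u v _|u v w _ uv _ vw].
- move=> p q t x a.
  have [m [c [s [mc c0 aE]]]] := simp_support (simp_val (mk_point (res X t x) a)).
  exists m, c, (inj_comp t s), s; split=> //=; first by rewrite res_comp.
  by rewrite push_row_comp -aE.
- exact: common_face_refl.
- exact: common_face_sym.
- exact: common_face_trans uv vw.
Qed.

(** For an interior point the common face is all of [x], so the identity factors through [t]. With
    [y = x] this says that two interior coordinate vectors of one point differ by an automorphism of
    [x]. *)
Lemma chi_pos p q (x : cells X p.+1) a (y : cells X q.+1) b :
  simp p a -> positive a -> simp q b -> chi x a = chi y b ->
  exists theta, res X theta y = x /\ b = push_row theta a.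
Proof.
move=> pa a0 qb /(chiP _ _ pa qb)[m [c [t [t' [[mc c0] xy aE bE]]]]].
have [h hE] : exists h, inj_id p.+1 = inj_comp t h.
  apply: inj_factor => _ [i _ <-]; apply: (@push_row_range R _ _ t c).
  by rewrite -aE.
have cE : c = push_row h a.
  by apply: (@push_row_inj _ _ _ t); rewrite -push_row_comp -hE push_row_id.
exists (inj_comp t' h); split; last by rewrite push_row_comp -cE.
by rewrite res_comp -xy -res_comp -hE res_id.
Qed.

Lemma chi_surj (y : T) : exists p (x : cells X p.+1) a,
  [/\ simp p a, positive a & y = chi x a].
Proof.
have [u <-] := proj_surj y; have [p [x [a [pa ->]]]] := rep_point_surj u.
have [m [c [t [mc c0 aE]]]] := simp_support pa.
by exists m, (res X t x), c; split=> //; rewrite -chi_push// -aE.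
Qed.

Lemma carrier_subproof (y : T) : exists s : simplex X, exists a,
  [/\ simp (tag s) a, positive a & y = chi (tagged s) a].
Proof.
have [p [x [a pxa]]] := chi_surj y.
by exists (mk_simplex x), a.
Qed.

(** The orbit whose open cell contains [y]; it does not depend on the choice made here, by
    [carrierE]. *)
Definition carrier (y : T) : sorbit X := sorbit_of (sval (cid (carrier_subproof y))).

Lemma carrierE p (x : cells X p.+1) a : simp p a -> positive a ->
  carrier (chi x a) = sorbit_of (mk_simplex x).
Proof.
move=> pa a0; rewrite /carrier; case: cid => -[q y] /= [b [qb b0 xy]].
have [t [tx bE]] := chi_pos pa a0 qb xy.
have [t' [ty aE]] := chi_pos qb b0 pa (esym xy).
by apply: sorbit_of_eq; [exists t'|exists t].
Qed.

Lemma carrier_face p (x : cells X p.+1) a : simp p a ->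
  (carrier (chi x a) <= sorbit_of (mk_simplex x))%O /\
  (~ positive a -> (odim (carrier (chi x a)) < p)%N).
Proof.
move=> /simp_support[m [c [t [mc c0 aE]]]].
rewrite aE chi_push// carrierE//; split.
  by apply/sorbit_ofP; exists t.
rewrite odim_of /= => apos.
have := leq_card _ (@inj_inj _ _ t); rewrite !card_ord ltnS leq_eqVlt.
(* In equal dimension [t] would be a permutation and every coordinate would be positive. *)
move=> /predU1P[mp|//]; exfalso; apply: apos => j.
case: _ / mp t j {x a aE} => t j; have [s sE] := perm_of_inj t.
by rewrite sE -[j](permKV s) -inj_of_permE push_rowE.
Qed.

Lemma carrier_pos p (x : cells X p.+1) a : simp p a ->
  carrier (chi x a) = sorbit_of (mk_simplex x) -> positive a.
Proof.
move=> pa aE; apply: contrapT => /(carrier_face x pa).2.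
by rewrite aE odim_of ltnn.
Qed.

Lemma carrier_rep (y : T) p (x : cells X p.+1) :
  carrier y = sorbit_of (mk_simplex x) ->
  exists a, [/\ simp p a, positive a & y = chi x a].
Proof.
have [q [z [b [qb b0 ->]]]] := chi_surj y; rewrite carrierE// => zx.
have [t tE] : is_face (mk_simplex z) (mk_simplex x).
  by apply/sorbit_ofP; rewrite zx.
have pa : simp p (push_row t b) by exact: push_row_in.
have aE : chi x (push_row t b) = chi z b by rewrite chi_push// tE.
exists (push_row t b); split=> //.
by apply: (@carrier_pos _ x) => //; rewrite aE carrierE.
Qed.

Lemma rep_point_ccont p (x : cells X p.+1) : ccont (simp p) (rep_point x).
Proof.
apply/ccontP; first exact: simp_closed.
apply/subspace_sigL_continuousP; rewrite (_ : sigL _ _ = mk_point x); last first.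
  by apply/funext => a; rewrite /sigL /= rep_pointE.
have pc : continuous (fun a : simp p =>
    ((x, a) : discrete_topology (cells X p.+1) * simp p)%type).
  by apply: continuous_pair; [exact: cst_continuous|move=> a; exact: cvg_id].
move=> a; apply: (@continuous_comp _ _ _ _ (existT _ p)); first exact: pc.
exact: existT_continuous.
Qed.

Lemma chi_ccont p (x : cells X p.+1) : ccont (simp p) (chi x).
Proof.
apply: (@ccont_comp _ _ _ _ setT (rep_point x) (proj _)) => //.
  exact: rep_point_ccont.
by apply/ccontT; exact: proj_continuous.
Qed.

Hypothesis finX : finite_set [set: simplex X].

Lemma realization_pre_compact : compact [set: realization_pre R X].
Proof.
rewrite (_ : [set: _] = \bigcup_(s in [set: simplex X])
    (rep_point (tagged s) @` simp (tag s))).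
  rewrite -bigsetU_fset_set//; apply: big_rec; first exact: compact0.
  move=> s A _ cA; apply: compactU => //.
  apply: compact_ccont_image; last exact: rep_point_ccont.
    exact: simp_compact.
  exact: simp_closed.
apply/seteqP; split=> // u _; have [p [x [a [pa ->]]]] := rep_point_surj u.
by exists (mk_simplex x) => //; exists a.
Qed.

Lemma realization_pre_hausdorff : hausdorff_space (realization_pre R X).
Proof.
apply: sigT_hausdorff => p; apply: hausdorff_prod.
  exact: discrete_hausdorff.
exact/set_type_hausdorff/norm_hausdorff.
Qed.

Lemma realization_compact : compact [set: T].
Proof.
rewrite (_ : [set: T] = proj _ @` [set: realization_pre R X]).
  apply: continuous_compact; last exact: realization_pre_compact.
  exact/continuous_subspaceT/proj_continuous.
by apply/seteqP; split=> // y _; have [u <-] := proj_surj y; exists u.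
Qed.

(** By [chiP] the gluing relation is a finite union, over pairs of simplices and pairs of injections
    giving a common face, of continuous images of compact simplices; hence it is closed. *)
Lemma realization_hausdorff : hausdorff_space T.
Proof.
apply: quo_hausdorff.
- exact: realization_pre_hausdorff.
- exact: realization_pre_compact.
pose F (s t : simplex X) m (f : inj_ord m.+1 (tag s).+1)
    (g : inj_ord m.+1 (tag t).+1) (c : 'rV[R]_m.+1) :=
  (rep_point (tagged s) (push_row f c), rep_point (tagged t) (push_row g c)).
rewrite (_ : mkset _ = \bigcup_(s in [set: simplex X])
    \bigcup_(t in [set: simplex X]) \bigcup_(m in `I_(tag s).+1)
    \bigcup_(f in [set: inj_ord m.+1 (tag s).+1])
    \bigcup_(g in [set g : inj_ord m.+1 (tag t).+1 |
      res X f (tagged s) = res X g (tagged t)]) (F s t m f g @` simp m)).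
  do 2 (apply: closed_bigcup => // ? _).
  apply: closed_bigcup => [|m _]; first exact: finite_II.
  apply: closed_bigcup => [|f _]; first exact: finite_finset.
  apply: closed_bigcup => [|g _]; first exact: finite_finset.
  have Fc p (x : cells X p.+1) (h : inj_ord m.+1 p.+1) :
      ccont (simp m) (fun c => rep_point x (push_row h c)).
    apply: (@ccont_comp _ _ _ _ (simp p) (push_row h) (rep_point x)).
    - by move=> c; exact: push_row_in.
    - by apply: continuous_ccont; [exact: simp_closed|exact: push_row_continuous].
    - exact: rep_point_ccont.
  apply: compact_closed.
    by apply: hausdorff_prod; exact: realization_pre_hausdorff.
  apply: compact_ccont_image; [exact: simp_compact|exact: simp_closed|].
  by apply: ccont_pair; [exact: simp_closed|exact: Fc|exact: Fc].
apply/seteqP; split=> [[u v] /= /projP|].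
  have [p [x [a [pa ->]]]] := rep_point_surj u.
  have [q [y [b [qb ->]]]] := rep_point_surj v.
  move=> /(chiP _ _ pa qb)[m [c [f [g [[mc _] fg -> ->]]]]].
  exists (mk_simplex x) => //; exists (mk_simplex y) => //; exists m.
    by have := leq_card _ (@inj_inj _ _ f); rewrite !card_ord.
  by exists f => //; exists g => //; exists c.
move=> _ [[p x] _ [[q y] _ [m _ [f _ [g /= fg [c mc <-]]]]]] /=; apply/projP.
by rewrite -/(chi _ _) -/(chi _ _) !chi_push// fg.
Qed.

End Characteristic.

(** * Homotopy extension *)

Section SupersetInduction.
Import finmap.

(** Induction on the size of the complement. [D'] may exceed [D] by more than one element because a
    matched pair is added in a single step. *)
Lemma superset_ind (T : choiceType) (P : set T -> Prop) :
  finite_set [set: T] ->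
  (forall D, (forall D' x, D `<=` D' -> D' x -> ~ D x -> P D') -> P D) ->
  forall D, P D.
Proof.
move=> finT IH D; pose c (A : set T) := (#|` fset_set (~` A)|)%fset.
have finC (A : set T) : finite_set A by exact: sub_finite_set finT.
have [n] := ubnP (c D); elim: n D => // n IHn D Dn.
apply: IH => D' x DD' D'x nDx; apply: IHn.
apply: leq_trans _ (ltnSE Dn); apply: fproper_ltn_card.
rewrite fproperE; apply/andP; split.
  apply/fsubsetP => y; rewrite !in_fset_set// => /set_mem nDy.
  by apply: mem_set => /DD'.
apply/negP => /fsubsetP/(_ x); rewrite !in_fset_set// => h.
by have /set_mem := h (mem_set nDx).
Qed.

End SupersetInduction.

Lemma ex_minimal (T : Type) (Q : T -> Prop) (h : T -> nat) :
  (exists x, Q x) -> exists2 x, Q x & forall y, Q y -> (h x <= h y)%N.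
Proof.
move=> [x Qx]; pose P n := `[< exists2 y, Q y & h y = n >].
have exP : exists n, P n by exists (h x); apply/asboolP; exists x.
case: (ex_minnP exP) => n /asboolP[y Qy <-] nmin.
by exists y => // z Qz; apply: nmin; apply/asboolP; exists z.
Qed.

Section MinimalCoordinate.
Variable R : realType.

(** [Num.min] has no neutral element on [R], so the first coordinate is the starting value. *)
Definition mincoord n (a : 'rV[R]_n.+1) : R :=
  \big[Num.min/a ord0 ord0]_i a ord0 i.

Lemma mincoord_le n (a : 'rV[R]_n.+1) i : mincoord a <= a ord0 i.
Proof. exact: bigmin_le. Qed.

Lemma mincoord_ex n (a : 'rV[R]_n.+1) : exists i, mincoord a = a ord0 i.
Proof.
rewrite /mincoord; elim/big_ind : _ => [|x y [i ->] [j ->]|i _].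
- by exists ord0.
- by case: leP => _; [exists i|exists j].
- by exists i.
Qed.

Lemma mincoordP n (a : 'rV[R]_n.+1) m : (forall i, m <= a ord0 i) ->
  (exists i, a ord0 i = m) -> mincoord a = m.
Proof.
move=> ma [i im]; apply/le_anti/andP; split; first by rewrite -im mincoord_le.
by have [j ->] := mincoord_ex a.
Qed.

Lemma mincoord_continuous n : continuous (@mincoord n).
Proof. by apply: rcont_bigmin => [|i]; exact: coord_continuous. Qed.

Lemma inj_endo_surj n (theta : inj_ord n n) j : exists i, theta i = j.
Proof.
have [s ->] := perm_of_inj theta; exists (s^-1%g j).
by rewrite inj_of_permE permKV.
Qed.

Lemma mincoord_push n (theta : inj_ord n.+1 n.+1) a :
  mincoord (push_row theta a) = mincoord a.
Proof.
apply: mincoordP => [j|].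
  by have [i <-] := inj_endo_surj theta j; rewrite push_rowE mincoord_le.
by have [i ->] := mincoord_ex a; exists (theta i); rewrite push_rowE.
Qed.

End MinimalCoordinate.

(** * Retraction of the cylinder over a simplex *)

Section RadialRetraction.
Variables (R : realType) (p : nat).
Implicit Types (a : 'rV[R]_p.+1) (t : R).
Local Notation simp := (std_simplex R p).
Local Notation c := (barycenter R p).

(* The gauge of the simplex centred at its barycenter. *)
Definition gauge a : R := 1 - p.+1%:R * mincoord a.

(* The retraction of [simp * [0, 1]] onto the union of its bottom and its
   lateral boundary: [a] is expanded from the barycenter by the factor [1 + t],
   and the part sticking out of the simplex is converted into time. *)
Definition overshoot a t : R := Num.max 1 ((1 + t) * gauge a).
Definition retr a t : 'rV[R]_p.+1 :=
  c + ((1 + t) / overshoot a t) *: (a - c).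
Definition retr_time a t : R := overshoot a t - 1.

Lemma gauge_bounds a : simp a -> 0 <= gauge a <= 1.
Proof.
move=> [a0 a1]; have [i iE] := mincoord_ex a; rewrite /gauge.
have : 0 <= mincoord a by rewrite iE.
have : p.+1%:R * mincoord a <= 1.
  rewrite -[leRHS]a1 mulr_natl -[X in _ *+ X]card_ord -sumr_const.
  by apply: ler_sum => j _; exact: mincoord_le.
have : 0 < p.+1%:R :> R by rewrite ltr0n.
by move: (mincoord a) (p.+1%:R) => m n n0 nm m0; nra.
Qed.

Lemma gauge_eq1 a : simp a -> ~ positive a -> gauge a = 1.
Proof.
move=> [a0 _] apos; rewrite /gauge (@mincoordP _ _ _ 0)// ?mulr0 ?subr0//.
apply: contrapT => na; apply: apos => i; rewrite lt_def a0 andbT.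
by apply/eqP => ai; apply: na; exists i.
Qed.

Lemma overshoot_ge1 a t : 1 <= overshoot a t.
Proof. by rewrite le_max lexx. Qed.

Lemma overshoot0 a : simp a -> overshoot a 0 = 1.
Proof.
by move=> /gauge_bounds/andP[_ g1]; rewrite /overshoot addr0 mul1r; apply/max_idPl.
Qed.

Lemma retr0 a : simp a -> retr a 0 = a.
Proof.
move=> ap; rewrite /retr overshoot0// addr0 divr1 scale1r.
by rewrite addrC subrK.
Qed.

Lemma retr_time0 a : simp a -> retr_time a 0 = 0.
Proof. by move=> ap; rewrite /retr_time overshoot0// subrr. Qed.

(** The gauge is 1 on the boundary, so the expansion is undone completely and turned into time. An
    extended homotopy thus agrees there with the given one. *)
Lemma retr_boundary a t : simp a -> ~ positive a -> 0 <= t ->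
  retr a t = a /\ retr_time a t = t.
Proof.
move=> ap na t0; have wE : overshoot a t = 1 + t.
  by rewrite /overshoot gauge_eq1// mulr1; apply/max_idPr; rewrite lerDl.
rewrite /retr /retr_time wE divff ?gt_eqF ?ltr_wpDr// scale1r.
by split; [rewrite addrC subrK|rewrite addrC addKr].
Qed.

Lemma retr_timeI a t : simp a -> 0 <= t <= 1 -> 0 <= retr_time a t <= 1.
Proof.
move=> /gauge_bounds g01 t01; rewrite /retr_time subr_ge0 overshoot_ge1/=.
by rewrite lerBlDr ge_max; nra.
Qed.

Lemma retrE a t i :
  retr a t ord0 i = p.+1%:R^-1 + (1 + t) / overshoot a t * (a ord0 i - p.+1%:R^-1).
Proof. by rewrite !mxE. Qed.

Lemma retr_in a t : simp a -> 0 <= t <= 1 -> simp (retr a t).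
Proof.
move=> ap t01; have [a0 a1] := ap; split=> [i|].
  rewrite retrE; have := mincoord_le a i; have := overshoot_ge1 a t.
  have : (1 + t) * gauge a <= overshoot a t by rewrite le_max lexx orbT.
  rewrite /gauge; move: (mincoord a) (overshoot a t) (a ord0 i) => m w x wE w1 mx.
  have w0 : 0 < w by exact: lt_le_trans w1.
  have n0 : 0 < p.+1%:R :> R by rewrite ltr0n.
  move: (p.+1%:R) n0 wE => n n0 wE.
  (* Multiplied by [n * w], the coordinate is [w + (1 + t) * (n * x - 1)], and [n * x - 1] is at
     least [n * m - 1], the opposite of the gauge. *)
  rewrite -(pmulr_rge0 _ n0) -(pmulr_rge0 _ w0).
  rewrite (_ : _ * (_ * _) = w + (1 + t) * (n * x - 1)); last first.
    by field; rewrite !gt_eqF.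
  suff : (1 + t) * (n * m - 1) <= (1 + t) * (n * x - 1) by lra.
  by rewrite ler_pM2l ?lerD2r ?ler_pM2l//; lra.
under eq_bigr do rewrite retrE.
rewrite big_split/= -mulr_sumr sumrB a1 sumr_const card_ord.
by rewrite -[_ *+ _]mulr_natl divff ?pnatr_eq0// subrr mulr0 addr0.
Qed.

(** Nonzero time means that the gauge term attains the maximum in [overshoot]; the point is then
    scaled to gauge 1 and its least coordinate vanishes. *)
Lemma retr_lateral a t : simp a -> 0 <= t <= 1 -> retr_time a t != 0 ->
  ~ positive (retr a t).
Proof.
move=> ap t01; rewrite /retr_time subr_eq0 => w1.
have wE : overshoot a t = (1 + t) * gauge a.
  by move: w1; rewrite /overshoot; case: leP => //; rewrite eqxx.
have w0 : 0 < overshoot a t by exact: lt_le_trans (overshoot_ge1 a t).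
have n0 : 0 < p.+1%:R :> R by rewrite ltr0n.
have [i iE] := mincoord_ex a => /(_ i); rewrite retrE -iE.
suff -> : p.+1%:R^-1 + (1 + t) / overshoot a t * (mincoord a - p.+1%:R^-1) = 0.
  by rewrite ltxx.
rewrite (_ : _ - _ = - gauge a / p.+1%:R); last first.
  by rewrite /gauge; move: (p.+1%:R) n0 => n n0; field; rewrite gt_eqF.
have := w0; rewrite {1}wE => w0'.
have g0 : gauge a != 0 by apply: contraTneq w0' => ->; rewrite mulr0 ltxx.
have t0 : 1 + t != 0 by apply: contraTneq w0' => ->; rewrite mul0r ltxx.
by rewrite wE; move: (p.+1%:R) n0 => n n0; field; rewrite g0 t0 gt_eqF.
Qed.

(** Barycenter and gauge are invariant under permutations, so the retraction is compatible with the
    automorphisms of a simplex. *)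
Lemma retr_push a t (theta : inj_ord p.+1 p.+1) :
  retr (push_row theta a) t = push_row theta (retr a t) /\
  retr_time (push_row theta a) t = retr_time a t.
Proof.
have wE : overshoot (push_row theta a) t = overshoot a t.
  by rewrite /overshoot /gauge mincoord_push.
split; last by rewrite /retr_time wE.
apply: push_rowP => [i|j jn]; first by rewrite !retrE wE push_rowE.
by have [i ij] := inj_endo_surj theta j; case: jn; exists i.
Qed.

Lemma gauge_continuous : continuous gauge.
Proof.
apply: rcontD; first exact: cst_continuous.
apply: rcontN; apply: rcontM; first exact: cst_continuous.
exact: mincoord_continuous.
Qed.

Lemma overshoot_continuous :
  continuous (fun u : 'rV[R]_p.+1 * R => overshoot u.1 u.2).
Proof.
apply: rcont_max; first exact: cst_continuous.
apply: rcontM.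
  by apply: rcontD => u; [exact: cvg_cst|exact: cvg_snd].
move=> u; apply: (@continuous_comp _ _ _ fst gauge).
  exact: cvg_fst.
exact: gauge_continuous.
Qed.

Lemma retr_continuous : continuous (fun u : 'rV[R]_p.+1 * R => retr u.1 u.2).
Proof.
apply: rV_continuous => j; rewrite (_ : (fun _ => _) =
    fun u : 'rV[R]_p.+1 * R => p.+1%:R^-1 + (1 + u.2) / overshoot u.1 u.2 *
      (u.1 ord0 j - p.+1%:R^-1)); last by apply/funext => u; rewrite retrE.
apply: rcontD; first exact: cst_continuous.
apply: rcontM; last first.
  apply: rcontD; last exact: cst_continuous.
  move=> u; apply: (@continuous_comp _ _ _ fst (fun a : 'rV[R]_p.+1 => a ord0 j)).
    exact: cvg_fst.
  exact: coord_continuous.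
apply: rcontM.
  by apply: rcontD => u; [exact: cvg_cst|exact: cvg_snd].
apply: rcontV; last exact: overshoot_continuous.
by move=> u; rewrite gt_eqF// (lt_le_trans _ (overshoot_ge1 _ _)).
Qed.

End RadialRetraction.

(** * Extending homotopies from subcomplexes *)

Section Subcomplexes.
Variables (R : realType) (X : sym_delta_complex).
Hypothesis finX : finite_set [set: simplex X].
Local Notation simp p := (std_simplex R p).
Local Notation T := (realization R X).
Local Notation I := (`[0, 1]%classic : set R).
Implicit Types (D : set (sorbit X)) (o : sorbit X).

Lemma sorbit_finite : finite_set [set: sorbit X].
Proof.
apply: sub_finite_set (finite_image (@sorbit_of X) finX) => o _.
by exists (orep o) => //; exact: orepK.
Qed.

Definition down_closed D := forall o o', (o <= o')%O -> D o' -> D o.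

Lemma down_closedU1 D o : down_closed D -> (forall o', (o' < o)%O -> D o') ->
  down_closed (D `|` [set o]).
Proof.
move=> Dd oD o1 o2 o12 [Do2|/= o2E]; first by left; exact: Dd Do2.
move: o12; rewrite o2E le_eqVlt => /predU1P[->|/oD]; first by right.
by left.
Qed.

Definition subreal D : set T := [set y | D (carrier y)].

Lemma subreal_closed D : down_closed D -> closed (subreal D).
Proof.
move=> Dd; rewrite (_ : subreal D = \bigcup_(s in [set s | D (sorbit_of s)])
    (chi (tagged s) @` simp (tag s))).
  apply: closed_bigcup; first exact: sub_finite_set finX.
  move=> s _; apply: compact_closed; first exact: realization_hausdorff.
  apply: compact_ccont_image; last exact: chi_ccont.
    exact: simp_compact.
  exact: simp_closed.
apply/seteqP; split=> [y Dy|_ [[p x] /= Dx [a pa <-]]]; last first.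
  by apply: Dd Dx; case: (carrier_face x pa).
have [p [x [a [pa a0 yE]]]] := chi_surj y.
by exists (mk_simplex x); [rewrite /= -(carrierE x pa a0) -yE|exists a].
Qed.

(** The cylinder over a closed simplex is compact, so its map onto the cylinder over the image is a
    quotient map. *)
Lemma cell_ccont p (x : cells X p.+1) (f : T * R -> T) :
  ccont (simp p `*` I) (fun u => f (chi x u.1, u.2)) ->
  ccont ((chi x @` simp p) `*` I) f.
Proof.
move=> fc; have cS : closed (simp p `*` I).
  by apply: closed_setX; [exact: simp_closed|exact: interval_closed].
rewrite (_ : _ `*` _ = (fun u => (chi x u.1, u.2)) @` (simp p `*` I)).
  apply: ccont_image => //.
  - by apply: hausdorff_prod; [exact: realization_hausdorff|exact: Rhausdorff].
  - by apply: compact_setX; [exact: simp_compact|exact: segment_compact].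
  apply: ccont_pair => //; last first.
    by apply: continuous_ccont => // u; exact: cvg_snd.
  apply: (@ccont_comp _ _ _ _ (simp p) fst (chi x)) => //; first by move=> u [].
    by apply: continuous_ccont => // u; exact: cvg_fst.
  exact: chi_ccont.
apply/seteqP; split=> [[_ t] [/= [a pa <-] tI]|_ [[a t] [/= pa tI] <-]].
  by exists (a, t).
by split=> //; exists a.
Qed.

(* The domain on which a partially constructed homotopy is required to be
   continuous. *)
Definition hdom D : set (T * R) := subreal D `*` I `|` [set: T] `*` [set 0].

Lemma hdom_closed D : down_closed D -> closed (hdom D).
Proof.
move=> Dd; apply: closedU; apply: closed_setX; try exact: closedT.
- exact: subreal_closed.
- exact: interval_closed.
- by apply: compact_closed; [exact: Rhausdorff|exact: compact_set1].
Qed.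

(** On the new cell, [H] is composed with the retraction of the cylinder onto its bottom and lateral
    boundary, where [H] is already under control. *)
Lemma extend_cell D o (H : T * R -> T) : down_closed D -> ~ D o ->
  (forall o', (o' < o)%O -> D o') -> ccont (hdom D) H ->
  (forall y, H (y, 0) = y) ->
  exists H' : T * R -> T, [/\ ccont (hdom (D `|` [set o])) H',
    forall y, H' (y, 0) = y & forall y t, D (carrier y) -> H' (y, t) = H (y, t)].
Proof.
move=> Dd nDo oD Hc H0; have [[p x] /esym oE] := sorbit_of_surj o.
rewrite -/(mk_simplex x) in oE.
have /choice[a aP] (y : T) : exists a : 'rV[R]_p.+1, carrier y = o ->
    [/\ simp p a, positive a & y = chi x a].
  have [yo|yo] := pselect (carrier y = o); last by exists 0.
  by have [a aP] := @carrier_rep R X y p x (etrans yo oE); exists a.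
pose H' (u : T * R) := if pselect (carrier u.1 = o)
  then H (chi x (retr (a u.1) u.2), retr_time (a u.1) u.2) else H u.
have H'D y t : carrier y <> o -> H' (y, t) = H (y, t).
  by rewrite /H' /=; case: pselect.
have H'chi b t : simp p b -> 0 <= t <= 1 ->
    H' (chi x b, t) = H (chi x (retr b t), retr_time b t).
  move=> pb t01; have [b0|nb] := pselect (positive b); last first.
    have [-> ->] := retr_boundary pb nb (proj1 (andP t01)).
    apply: H'D => bo; apply: nb; apply: (@carrier_pos _ _ _ x) => //.
    by rewrite bo.
  have bo : carrier (chi x b) = o by rewrite carrierE.
  rewrite /H' /=; case: pselect => // ?.
  have [pa a0 ab] := aP _ bo.
  (* The chosen coordinates differ from [b] by an automorphism of [x], with which the retraction
     commutes. *)
  have [f [fx ->]] := chi_pos pb b0 pa ab.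
  have [-> ->] := retr_push b t f.
  by rewrite chi_push ?fx//; exact: retr_in.
have H'0 y : H' (y, 0) = y.
  have [yo|yo] := pselect (carrier y = o); last by rewrite H'D.
  have [pa a0 yE] := aP _ yo; rewrite yE H'chi ?lexx ?ler01//.
  by rewrite retr0// retr_time0// H0.
exists H'; split=> //; last first.
  by move=> y t Dy; apply: H'D => yo; apply: nDo; rewrite -yo.
have Do := down_closedU1 Dd oD.
apply: (@ccontS _ _ _ (hdom D `|` (chi x @` simp p) `*` I)).
- exact: hdom_closed.
- move=> [y t] [[/= [Dy|yo] tI]|[_ t0]]; first by left; left.
    by right; split=> //=; have [pa a0 yE] := aP _ yo; exists (a y).
  by left; right.
apply: ccontU.
  apply: ccont_eq Hc => -[y t] /set_mem [[/= Dy _]|[_ /= ->]].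
    by rewrite H'D// => yo; apply: nDo; rewrite -yo.
  by rewrite H'0 H0.
apply: cell_ccont; apply: (@ccont_eq _ _ _ (fun u =>
    H (chi x (retr u.1 u.2), retr_time u.1 u.2))).
  move=> [b t] /set_mem [/= pb]; rewrite in_itv/= => tI.
  by rewrite H'chi.
have cS : closed (simp p `*` I).
  by apply: closed_setX; [exact: simp_closed|exact: interval_closed].
apply: (@ccont_comp _ _ _ _ (hdom D) (fun u : 'rV[R]_p.+1 * R =>
    (chi x (retr u.1 u.2), retr_time u.1 u.2)) H) => //.
  move=> [b t] [/= pb]; rewrite /= in_itv/= => tI.
  (* The retracted point is at time 0, or on the lateral boundary and so carried by a proper face of
     [o], which belongs to [D]. *)
  have [s0|/eqP s0] := pselect (retr_time b t = 0); first by right; rewrite /= s0.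
  left; split=> /=; last by rewrite in_itv/= retr_timeI.
  apply: oD; rewrite lt_neqAle oE (carrier_face x (retr_in pb tI)).1 andbT.
  apply/eqP => /(carrier_pos (retr_in pb tI)).
  exact: retr_lateral.
apply: ccont_pair => //; last first.
  apply: continuous_ccont => //; apply: rcontD; last exact: cst_continuous.
  exact: overshoot_continuous.
apply: (@ccont_comp _ _ _ _ (simp p) (fun u => retr u.1 u.2) (chi x)).
- move=> [b t] [/= pb]; rewrite /= in_itv/= => tI; exact: retr_in.
- by apply: continuous_ccont => //; exact: retr_continuous.
- exact: chi_ccont.
Qed.

(** A missing orbit of least dimension has all its proper faces in [D], so cells can be filled in
    one by one. *)
Lemma homotopy_extension D (H : T * R -> T) : down_closed D ->
  ccont (hdom D) H -> (forall y, H (y, 0) = y) ->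
  exists H' : T * R -> T, [/\ ccont ([set: T] `*` I) H',
    forall y, H' (y, 0) = y & forall y t, D (carrier y) -> H' (y, t) = H (y, t)].
Proof.
move: D H; apply: (superset_ind sorbit_finite) => D IH H Dd Hc H0.
have [[o0 nDo0]|allD] := pselect (exists o, ~ D o); last first.
  exists H; split=> //; apply: ccontS Hc; first exact: closed_cylinder.
  move=> [y t] [_ tI]; left; split=> //; apply: contrapT => ny.
  by apply: allD; exists (carrier y).
have [|o nDo omin] := @ex_minimal _ (fun o => ~ D o) (@odim X); first by exists o0.
have oD o' : (o' < o)%O -> D o'.
  move=> /odim_lt oo'; apply: contrapT => /omin.
  by rewrite leqNgt oo'.
have [H1 [H1c H10 H1E]] := extend_cell Dd nDo oD Hc H0.
have Do := down_closedU1 Dd oD.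
have [H' [H'c H'0 H'E]] :=
  IH (D `|` [set o]) o (@subsetUl _ _ _) (or_intror erefl) nDo H1 Do H1c H10.
exists H'; split=> // y t Dy.
by rewrite H'E ?H1E//; left.
Qed.

End Subcomplexes.

(** * Collapsing a permissible pair *)

Section VertexPush.
Variables (R : realType) (p : nat) (v : 'I_p.+2).
Implicit Types (a : 'rV[R]_p.+2) (t : R).
Local Notation simp := (std_simplex R p.+1).

Definition minface a : R := mincoord (\row_(i < p.+1) a ord0 (lift v i)).

Lemma minface_le a i : i != v -> minface a <= a ord0 i.
Proof.
rewrite eq_sym => /unlift_some[j -> _].
by have := mincoord_le (\row_(i < p.+1) a ord0 (lift v i)) j; rewrite mxE.
Qed.

Lemma minface_ex a : exists2 i, i != v & minface a = a ord0 i.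
Proof.
have [j jE] := mincoord_ex (\row_(i < p.+1) a ord0 (lift v i)).
exists (lift v j); first by rewrite eq_sym neq_lift.
by rewrite /minface jE mxE.
Qed.

Lemma minfaceP a m : (forall i, i != v -> m <= a ord0 i) ->
  (exists2 i, i != v & a ord0 i = m) -> minface a = m.
Proof.
move=> ma [i iv im]; apply/le_anti/andP; split; first by rewrite -im minface_le.
by have [j jv ->] := minface_ex a; exact: ma.
Qed.

(** The union of the facets containing the vertex [v]. *)
Definition horn a := exists2 i, i != v & a ord0 i = 0.

Lemma not_horn a : simp a -> ~ horn a -> forall i, i != v -> 0 < a ord0 i.
Proof.
move=> [a0 _] nh i iv; rewrite lt_def a0 andbT.
by apply/eqP => ai; apply: nh; exists i.
Qed.

(* Moves [a] straight away from the facet opposite to [v], until the horn is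
   reached at time [1]. *)
Definition vpush a t : 'rV[R]_p.+2 := \row_i
  (if i == v then a ord0 i + p.+1%:R * (t * minface a)
   else a ord0 i - t * minface a).

Lemma vpushE a t i : vpush a t ord0 i =
  if i == v then a ord0 i + p.+1%:R * (t * minface a)
  else a ord0 i - t * minface a.
Proof. by rewrite mxE. Qed.

Lemma vpush0 a : vpush a 0 = a.
Proof.
by apply/rowP => i; rewrite vpushE mul0r mulr0 addr0 subr0 if_same.
Qed.

Lemma minface_ge0 a : simp a -> 0 <= minface a.
Proof. by move=> [a0 _]; have [i _ ->] := minface_ex a. Qed.

Lemma minface_horn a : simp a -> horn a -> minface a = 0.
Proof. by move=> [a0 _] ah; apply: minfaceP. Qed.

Lemma vpush_horn a t : simp a -> horn a -> vpush a t = a.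
Proof.
move=> ap ah; apply/rowP => i.
by rewrite vpushE minface_horn// !mulr0 addr0 subr0 if_same.
Qed.

Lemma vpush_in a t : simp a -> 0 <= t <= 1 -> simp (vpush a t).
Proof.
move=> ap t01; have m0 := minface_ge0 ap; have [a0 a1] := ap; split=> [i|].
  rewrite vpushE; case: ifPn => [_|iv].
    by rewrite addr_ge0// !mulr_ge0//; case/andP: t01.
  by have := minface_le a iv; rewrite subr_ge0 => /(le_trans _); apply; nra.
(* The [p.+1] coordinates other than [v] lose [t * minface a] each, and [v] receives the total. *)
rewrite -[RHS]a1 (bigD1 v)//= [RHS](bigD1 v)//= vpushE eqxx -addrA; congr (_ + _).
rewrite (eq_bigr (fun i => a ord0 i - t * minface a)) => [|i iv]; last first.
  by rewrite vpushE (negbTE iv).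
rewrite sumrB addrCA sumr_const cardC1 card_ord.
by rewrite -[X in _ - X]mulr_natl subrr addr0.
Qed.

Lemma minface_vpush a t : minface (vpush a t) = (1 - t) * minface a.
Proof.
apply: minfaceP => [i iv|].
  by rewrite vpushE (negbTE iv) mulrBl mul1r lerD2r minface_le.
have [i iv iE] := minface_ex a; exists i => //.
by rewrite vpushE (negbTE iv) -iE mulrBl mul1r.
Qed.

Lemma vpush1_horn a : horn (vpush a 1).
Proof.
have [i iv iE] := minface_ex a; exists i => //.
by rewrite vpushE (negbTE iv) mul1r iE subrr.
Qed.

(** Stopping on the way does not change the endpoint, since the point stays on its trajectory and
    the push from there lasts until the horn. This is what lets the push descend to the new
    quotient. *)
Lemma vpush_vpush1 a t : vpush (vpush a t) 1 = vpush a 1.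
Proof.
apply/rowP => i; rewrite !vpushE minface_vpush; case: (i == v); ring.
Qed.

(** Only symmetries fixing [v] are allowed, since [v] is treated differently from the other
    vertices; permissibility supplies exactly these. *)
Lemma vpush_push a t (theta : inj_ord p.+2 p.+2) : theta v = v ->
  vpush (push_row theta a) t = push_row theta (vpush a t).
Proof.
move=> tv; have tN i : (theta i == v) = (i == v).
  by apply/eqP/eqP => [iv|->//]; apply: (@inj_inj _ _ theta); rewrite tv.
have mE : minface (push_row theta a) = minface a.
  apply: minfaceP => [i|].
    have [j <-] := inj_endo_surj theta i.
    by rewrite tN push_rowE; exact: minface_le.
  by have [i iv ->] := minface_ex a; exists (theta i); rewrite ?tN// push_rowE.
apply: push_rowP => [i|j jn]; first by rewrite !vpushE mE tN push_rowE.
by have [i ij] := inj_endo_surj theta j; case: jn; exists i.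
Qed.

Lemma vpush_continuous : continuous (fun u : 'rV[R]_p.+2 * R => vpush u.1 u.2).
Proof.
have mc : continuous (fun u : 'rV[R]_p.+2 * R => u.2 * minface u.1).
  apply: rcontM; first by move=> u; exact: cvg_snd.
  move=> u; apply: (@continuous_comp _ _ _ fst minface); first exact: cvg_fst.
  apply: continuous_comp; last exact: mincoord_continuous.
  apply: rV_continuous => j.
  rewrite (_ : (fun _ => _) = fun a : 'rV[R]_p.+2 => a ord0 (lift v j)).
    exact: coord_continuous.
  by apply/funext => x; rewrite mxE.
have cc i : continuous (fun u : 'rV[R]_p.+2 * R => u.1 ord0 i).
  move=> u; apply: (@continuous_comp _ _ _ fst (fun a : 'rV[R]_p.+2 => a ord0 i)).
    exact: cvg_fst.
  exact: coord_continuous.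
apply: rV_continuous => i; case: (altP (i =P v)) => iv.
  rewrite (_ : (fun _ => _) = fun u : 'rV[R]_p.+2 * R =>
    u.1 ord0 i + p.+1%:R * (u.2 * minface u.1)).
    by apply: rcontD => //; apply: rcontM => //; exact: cst_continuous.
  by apply/funext => u; rewrite vpushE iv eqxx.
rewrite (_ : (fun _ => _) = fun u : 'rV[R]_p.+2 * R =>
    u.1 ord0 i - u.2 * minface u.1).
  by apply: rcontD => //; exact: rcontN.
by apply/funext => u; rewrite vpushE (negbTE iv).
Qed.

End VertexPush.

Section FacetVertex.
Context {p : nat}.

Lemma inj_lift_subproof (v : 'I_p.+2) : injectiveb [ffun i : 'I_p.+1 => lift v i].
Proof. by apply/injectiveP => i j; rewrite !ffunE; exact: lift_inj. Qed.

Definition inj_lift v : inj_ord p.+1 p.+2 := mk_inj (inj_lift_subproof v).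

Lemma facet_vertex (rho : inj_ord p.+1 p.+2) :
  exists v, forall i, range rho i <-> i != v.
Proof.
have [v nv] : exists v, ~ range rho v.
  apply: contrapT => all_rho.
  have [|h _] := @inj_factor p.+2 p.+1 p.+2 rho (inj_id p.+2).
    by move=> i _; apply: contrapT => ni; apply: all_rho; exists i.
  have := leq_card _ (@inj_inj _ _ h).
  by rewrite !card_ord ltnn.
exists v => i; split=> [ri|iv]; first by apply: contra_notN nv => /eqP <-.
have liftE j : inj_lift v j = lift v j by rewrite /inj_fun/= ffunE.
(* The factor [h] is an injection between sets of equal size, so [rho] reaches every vertex other
   than [v]. *)
have [|h hE] := @inj_factor _ _ _ (inj_lift v) rho.
  move=> _ [j _ <-]; have : rho j != v.
    by apply: contra_notN nv => /eqP <-; exists j.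
  by rewrite eq_sym => /unlift_some[k kE _]; exists k; rewrite // liftE.
move: iv; rewrite eq_sym => /unlift_some[j -> _].
have [k kj] := inj_endo_surj h j.
by exists k; rewrite // hE inj_compE liftE kj.
Qed.

End FacetVertex.

(** * Symmetries and collapse of a permissible pair *)

Section PermissibleFace.
Variables (R : realType) (X : sym_delta_complex).
Hypothesis finX : finite_set [set: simplex X].
Variables (p : nat) (alpha : cells X p.+1) (beta : cells X p.+2).
Hypothesis perm : permissible_face alpha beta.
Local Notation simp p := (std_simplex R p).
Local Notation T := (realization R X).
Local Notation I := (`[0, 1]%classic : set R).
Local Notation oa := (sorbit_of (mk_simplex alpha)).
Local Notation ob := (sorbit_of (mk_simplex beta)).

(** Surjectivity of the isomorphism of automorphism groups, with the extension of [tau] made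
    explicit. *)
Lemma permissible_extend (rho : inj_ord p.+1 p.+2) (tau : 'S_p.+1) :
  res X rho beta = alpha ->
  (forall theta theta' : inj_ord p.+1 p.+2,
    res X theta beta = alpha -> res X theta' beta = alpha ->
    range theta = range theta') ->
  misom (simplex_aut beta) (simplex_aut alpha) (restrict_along rho) ->
  res X (inj_of_perm tau) alpha = alpha -> exists2 pi : 'S_p.+2,
    res X (inj_of_perm pi) beta = beta & forall i, rho (tau i) = pi (rho i).
Proof.
move=> rb uniq_im /andP[_ /eqP isoE] ta.
(* [misom] compares the images of nonidentity elements, so the identity is treated apart. *)
have [->|t1] := eqVneq tau 1%g.
  exists 1%g => [|i]; last by rewrite !perm1.
  rewrite -[RHS](@res_id X); congr res.
  by apply: inj_ext => i; rewrite inj_of_permE perm1 inj_idE.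
have : tau \in ((simplex_aut alpha)^#)%g by rewrite !inE t1 ta eqxx.
rewrite -isoE => /imsetP[pi]; rewrite !inE => /andP[_ /eqP pib] ->.
exists pi => [//|i].
have pre j : exists k, rho k = pi (rho j).
  have rE : range rho = range (inj_comp (inj_of_perm pi) rho).
    by apply: uniq_im => //; rewrite res_comp pib.
  have : range rho (pi (rho j)).
    by rewrite rE; exists j => //; rewrite inj_compE inj_of_permE.
  by move=> [k _ kE]; exists k.
(* By [pre] the search in [restrict_along] always succeeds, so neither of its default values
   occurs. *)
pose g := [ffun i : 'I_p.+1 => odflt i [pick j | rho j == pi (rho i)]].
have gE j : rho (g j) = pi (rho j).
  rewrite ffunE; case: pickP => [k /eqP//|nk]; have [k kE] := pre j.
  by have := nk k; rewrite kE eqxx.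
have gI : injectiveb g.
  apply/injectiveP => j k jk; apply: (@inj_inj _ _ rho); apply: (@perm_inj _ pi).
  by rewrite -!gE jk.
by rewrite -gE /restrict_along -/g -pvalE insubdK.
Qed.

(** Uniqueness of the image makes every automorphism of [beta] preserve the image of [rho], hence
    fix the omitted vertex. A point off the horn is interior to [beta] or to the facet opposite to
    [v]; in the second case its representatives differ by an automorphism of [alpha], which extends
    to [beta]. *)
Lemma permissible_vertex : exists v : 'I_p.+2, exists rho : inj_ord p.+1 p.+2,
  [/\ res X rho beta = alpha, forall i, range rho i <-> i != v,
    (forall theta, res X theta beta = beta -> theta v = v) &
    forall a b, simp p.+1 a -> ~ horn v a -> simp p.+1 b ->
      chi beta a = chi beta b -> exists theta,
      [/\ res X theta beta = beta, theta v = v & b = push_row theta a]].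
Proof.
have [rho [rb uniq_im iso]] := perm; have [v rhoP] := facet_vertex rho.
have fixv theta : res X theta beta = beta -> theta v = v.
  move=> tb; apply/eqP; apply: contrapT => /negP /rhoP.
  rewrite (uniq_im rho (inj_comp theta rho)) ?res_comp ?tb// => -[i _].
  rewrite inj_compE => /inj_inj iv.
  by have := (rhoP v).1; rewrite eqxx => /(_ (ex_intro2 _ _ i Logic.I iv)).
exists v, rho; split=> // a b pa /(not_horn pa) a0 pb ab.
have [av|av] := pselect (0 < a ord0 v).
  have apos : positive a by move=> i; have [->//|/a0] := eqVneq i v.
  have [t [tb bE]] := chi_pos pa apos pb ab.
  by exists t; split=> //; exact: fixv.
have av0 : a ord0 v = 0.
  by apply/le_anti; rewrite {1}leNgt; case: pa => -> _; rewrite andbT; exact/negP.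
pose c : 'rV[R]_p.+1 := \row_i a ord0 (rho i).
have aE : a = push_row rho c.
  apply: push_rowP => [i|j jn]; first by rewrite mxE.
  by have [->//|jv] := eqVneq j v; case: jn; apply/rhoP.
have pc : simp p c.
  split=> [i|]; first by rewrite mxE; case: pa.
  by rewrite -(push_row_sum rho) -aE; case: pa.
have cpos : positive c.
  by move=> i; rewrite mxE; apply: a0; apply/rhoP; exists i.
have cb : chi alpha c = chi beta b by rewrite -ab aE chi_push// rb.
have [t [tb bE]] := chi_pos pc cpos pb cb.
(* Uniqueness of the image puts [b] on the same facet as [a]. *)
have [h hE] : exists h, t = inj_comp rho h.
  by apply: inj_factor; rewrite (uniq_im _ _ tb rb).
have [s sE] := perm_of_inj h.
have [|pi pib piE] := permissible_extend (tau := s) rb uniq_im iso.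
  by rewrite -sE -[in LHS]rb -res_comp -hE.
exists (inj_of_perm pi); split=> //; first exact: fixv.
rewrite bE; have -> : t = inj_comp (inj_of_perm pi) rho.
  apply: inj_ext => i.
  by rewrite hE sE !inj_compE !inj_of_permE piE.
by rewrite push_row_comp -aE.
Qed.

(* The elementary collapse through the free face [alpha] of [beta], extended to
   a homotopy of the whole realization. *)
Lemma collapse_pair (D : set (sorbit X)) : down_closed D -> ~ D oa -> ~ D ob ->
  (forall o, (o < ob)%O -> o <> oa -> D o) ->
  let D' := D `|` [set oa; ob] in
  exists H : T * R -> T, [/\ down_closed D', ccont ([set: T] `*` I) H,
    forall y, H (y, 0) = y, forall y t, D (carrier y) -> H (y, t) = y &
    forall y t, D' (carrier y) -> 0 <= t <= 1 ->
      [/\ D' (carrier (H (y, t))), H (H (y, t), 1) = H (y, 1),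
        D (carrier (H (y, 1))) &
        (odim (carrier (H (y, 1%R))) <= odim (carrier y))%N]].
Proof.
move=> Dd nDa nDb Dlt D'.
have [v [rho [rb rhoP fixv chi_eq]]] := permissible_vertex.
have ltab : (oa < ob)%O.
  rewrite lt_def; apply/andP; split; last by apply/sorbit_ofP; exists rho.
  by apply/eqP => /(congr1 (@odim X)); rewrite !odim_of /= => /eqP; rewrite gtn_eqF.
have D'd : down_closed D'.
  move=> o1 o2 o12 [Do2|/= o2ab]; first by left; exact: Dd Do2.
  have [->|o1a] := pselect (o1 = oa); first by right; left.
  have [->|o1b] := pselect (o1 = ob); first by right; right.
  left; apply: Dlt => //; rewrite lt_neqAle; apply/andP; split; first exact/eqP.
  by case: o2ab => o2E; rewrite o2E in o12 => //; exact: le_trans (ltW ltab).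
have leD' o : (o <= ob)%O -> D' o by move=> ob_; apply: D'd ob_ _; right; right.
pose top (y : T) := carrier y = oa \/ carrier y = ob.
(* The two open cells of the pair are exactly what the push moves off, so [H0] may be the identity
   elsewhere. *)
have topP b : simp p.+1 b -> top (chi beta b) <-> ~ horn v b.
  move=> pb; split=> [tb [i iv bi]|nh].
    case: tb => [ca|cb]; last first.
      by have := carrier_pos pb cb i; rewrite bi ltxx.
    have [c [pc c0 cE]] := carrier_rep ca.
    have [t [tb bE]] := chi_pos pc c0 pb (esym cE).
    (* All gluings of [alpha] to [beta] have the same image, so the zero coordinate [i] would be
       among the positive ones. *)
    have ri : range t i.
      have [r [_ uniq_im _]] := perm; rewrite (uniq_im t rho tb rb).
      by apply/rhoP.
    by case: ri bi => k _ <-; rewrite bE push_rowE => ck; have := c0 k; rewrite ck ltxx.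
  have b0 := not_horn pb nh.
  have [bv|bv] := pselect (0 < b ord0 v).
    right; apply: carrierE => // i.
    by have [->//|/b0] := eqVneq i v.
  have bv0 : b ord0 v = 0.
    by apply/le_anti; rewrite {1}leNgt; case: pb => -> _; rewrite andbT; exact/negP.
  pose c : 'rV[R]_p.+1 := \row_i b ord0 (rho i).
  have bE : b = push_row rho c.
    apply: push_rowP => [i|j jn]; first by rewrite mxE.
    by have [->//|jv] := eqVneq j v; case: jn; apply/rhoP.
  have pc : simp p c.
    split=> [i|]; first by rewrite mxE; case: pb.
    by rewrite -(push_row_sum rho) -bE; case: pb.
  left; rewrite bE chi_push// rb carrierE// => i.
  by rewrite mxE; apply: b0; apply/rhoP; exists i.
have top_chi y : top y -> exists a : 'rV[R]_p.+2, simp p.+1 a /\ y = chi beta a.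
  move=> [/carrier_rep|/carrier_rep] [c [pc _ ->]]; last by exists c.
  by exists (push_row rho c); split; [exact: push_row_in|rewrite chi_push// rb].
have /choice[a aP] (y : T) : exists a : 'rV[R]_p.+2,
    top y -> simp p.+1 a /\ y = chi beta a.
  have [ty|ty] := pselect (top y); last by exists 0.
  by have [a aP] := top_chi _ ty; exists a.
pose H0 (u : T * R) := if pselect (top u.1) then chi beta (vpush v (a u.1) u.2) else u.1.
have H0N y t : ~ top y -> H0 (y, t) = y by rewrite /H0 /=; case: pselect.
have H0chi b t : simp p.+1 b -> 0 <= t <= 1 ->
    H0 (chi beta b, t) = chi beta (vpush v b t).
  move=> pb t01; have [bh|nh] := pselect (horn v b).
    by rewrite vpush_horn// H0N// (topP _ pb).
  have tb := (topP _ pb).2 nh.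
  rewrite /H0 /=; case: pselect => // ?.
  have [pa ab] := aP _ tb.
  have [f [fb fv ->]] := chi_eq _ _ pb nh pa ab.
  by rewrite vpush_push// chi_push ?fb//; exact: vpush_in.
have DN y : D (carrier y) -> ~ top y by move=> Dy [] yE; rewrite yE in Dy.
have H00 y : H0 (y, 0) = y.
  have [ty|/H0N//] := pselect (top y).
  have [pa yE] := aP _ ty.
  by rewrite {1}yE H0chi ?lexx ?ler01// vpush0 -yE.
have H0c : ccont (@hdom R X D') H0.
  apply: (@ccontS _ _ _ (@hdom R X D `|` (chi beta @` simp p.+1) `*` I)).
  - exact: hdom_closed.
  - move=> [y t] [[/= Dy tI]|[_ t0]]; last by left; right.
    have [ty|nty] := pselect (top y).
      by right; split=> //=; have [pa yE] := aP _ ty; exists (a y).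
    left; left; split=> //=; case: Dy => [Dy|tab]; [exact: Dy|exfalso; apply: nty].
    by case: tab => h; [left|right].
  apply: ccontU.
    apply: (@ccont_eq _ _ _ fst).
      move=> [y t] /set_mem [[/= Dy _]|[_ /= ->]]; last by rewrite H00.
      by rewrite H0N//; exact: DN.
    by apply: continuous_ccont; [exact: hdom_closed|move=> u; exact: cvg_fst].
  apply: cell_ccont => //; apply: (@ccont_eq _ _ _ (fun u =>
      chi beta (vpush v u.1 u.2))).
    move=> [b t] /set_mem [/= pb]; rewrite in_itv/= => tI.
    by rewrite H0chi.
  have cS : closed (simp p.+1 `*` I).
    by apply: closed_setX; [exact: simp_closed|exact: interval_closed].
  apply: (@ccont_comp _ _ _ _ (simp p.+1) (fun u => vpush v u.1 u.2) (chi beta)).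
  - move=> [b t] [/= pb]; rewrite /= in_itv/= => tI; exact: vpush_in.
  - by apply: continuous_ccont => //; exact: vpush_continuous.
  - exact: chi_ccont.
have [H [Hc HT0 HE]] := homotopy_extension finX D'd H0c H00.
exists H; split=> //.
  move=> y t Dy; rewrite HE; last by left.
  by rewrite H0N//; exact: DN.
move=> y t D'y t01; have t1 : 0 <= (1 : R) <= 1 by rewrite ler01 lexx.
have [ty|nty] := pselect (top y); last first.
  have Dy : D (carrier y).
    case: D'y => [//|tab]; exfalso; apply: nty.
    by case: tab => h; [left|right].
  by rewrite !HE ?H0N// (H0N y t) ?HE ?H0N//; left.
have [pa yE] := aP _ ty; move: (a y) pa yE => b pb yE.
have leb c : simp p.+1 c -> D' (carrier (chi beta c)).
  by move=> pc; apply: leD'; case: (carrier_face beta pc).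
have HtE : H (y, t) = chi beta (vpush v b t) by rewrite HE// yE H0chi.
have H1E : H (y, 1) = chi beta (vpush v b 1) by rewrite HE// yE H0chi.
have pt : simp p.+1 (vpush v b t) by exact: vpush_in.
have p1 : simp p.+1 (vpush v b 1) by exact: vpush_in.
have Nt1 : ~ top (H (y, 1)) by rewrite H1E (topP _ p1) => h; apply: h; exact: vpush1_horn.
split.
- by rewrite HtE; exact: leb.
- by rewrite HtE HE ?H0chi ?vpush_vpush1//; exact: leb.
- have := leb _ p1; rewrite -H1E => -[//|tab]; exfalso; apply: Nt1.
  by case: tab => h; [left|right].
(* The endpoint lies on the boundary of [beta], in dimension at most [p], while the start has
   dimension [p] or [p.+1]. *)
rewrite H1E; apply: (@leq_trans p); last first.
  by case: ty => ->; rewrite odim_of.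
rewrite -ltnS; apply: (carrier_face beta p1).2.
move=> pos; have [i _ iE] := vpush1_horn v b.
by have := pos i; rewrite iE ltxx.
Qed.

End PermissibleFace.

(** * The reduction to critical cells *)

Section AcyclicRank.
Context {d : Order.disp_t} {P : porderType d}.
Implicit Type M : set (P * P).

(* The rank of [b] counts the elements from which [b] can be reached along
   alternating paths. *)
Lemma acyclic_rank M : finite_set [set: P] -> acyclic_matching M ->
  exists (h : P -> nat) (B : nat), (forall b, (h b < B)%N) /\
    forall a b b', M (a, b) -> covered_by a b' -> b <> b' -> (h b < h b')%N.
Proof.
move=> /finite_seqP[s sE] acyc; pose F : finType := seq_sub s.
have in_s x : x \in s by have : [set: P] x by []; rewrite sE.
pose N b b' := exists a, [/\ M (a, b), covered_by a b' & b <> b'].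
pose e : rel F := fun x y => `[< N (val x) (val y) >].
have noback x y : e x y -> ~~ connect e y x.
  (* A way back from [y] to [x], shortened to distinct vertices and closed by the edge from [x] to
     [y], is a forbidden cycle. It has length at least 2 since [e] excludes loops. *)
  move=> exy; apply/negP => /connectP[q0 q0path xE].
  move: xE; case/shortenP: q0path => q qpath quniq _ xE {q0}.
  pose n := size (y :: q); pose b (i : 'I_n) : P := val (nth y (y :: q) i).
  have bN i : N (b i) (b (ordS i)).
    rewrite /b /=; have : (i < (size q).+1)%N := ltn_ord i; rewrite ltnS leq_eqVlt.
    move=> /predU1P[iE|iq].
      rewrite iE modnn -last_nth -xE /=; exact/asboolP.
    rewrite modn_small ?ltnS//=.
    by apply/asboolP; have /pathP := qpath => /(_ y _ iq).
  have /choice[a aP] := bN.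
  apply: acyc; exists n, a, b; split.
  - rewrite /n /= ltnS lt0n; apply/eqP => /size0nil q0.
    move: exy; rewrite xE q0 /= => /asboolP[? [_ _]].
    by [].
  - move=> i j /val_inj /eqP.
    by rewrite nth_uniq// => /eqP/val_inj.
  - by move=> i; case: (aP i).
  - by move=> i; case: (aP i).
pose h (b : P) := #|[pred c : F | connect e c (SeqSub (in_s b))]|.
exists h, #|F|.+1; split=> [b|a b b' Mab ab' bb']; first by rewrite ltnS max_card.
have ebb' : e (SeqSub (in_s b)) (SeqSub (in_s b')) by apply/asboolP; exists a.
apply: proper_card; apply/properP; split.
  apply/fintype.subsetP => c; rewrite !inE => cb.
  exact: connect_trans cb (connect1 ebb').
(* [b'] is counted for itself but, by [noback], not for [b]. *)
exists (SeqSub (in_s b')); rewrite !inE ?connect0//.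
exact: noback.
Qed.

Lemma matching_lower_uniq M a b b' :
  matching M -> M (a, b) -> M (a, b') -> b = b'.
Proof.
move=> [_ uniqM] Mb Mb'.
by have [] := uniqM a _ _ Mb Mb' (or_introl erefl) (or_introl erefl).
Qed.

Lemma matching_upper_uniq M a a' b :
  matching M -> M (a, b) -> M (a', b) -> a = a'.
Proof.
move=> [_ uniqM] Mb Mb'.
by have [] := uniqM b _ _ Mb Mb' (or_intror erefl) (or_intror erefl).
Qed.

Lemma matching_no_chain M a b c : matching M -> M (a, b) -> ~ M (b, c).
Proof.
move=> mM Mab Mbc; have [Mcov uniqM] := mM.
have [ab _] := uniqM b _ _ Mab Mbc (or_intror erefl) (or_introl erefl).
by have [] := Mcov _ _ Mab; rewrite ab ltxx.
Qed.

End AcyclicRank.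

Section Levels.
Variable X : sym_delta_complex.
Hypothesis finX : finite_set [set: simplex X].

(** If at least two vertices are missing from the image of the gluing injection, adding just one of
    them gives an intermediate face. *)
Lemma covered_dim (a b : sorbit X) : covered_by a b -> odim b = (odim a).+1.
Proof.
have [[p x] <-] := sorbit_of_surj a; have [[q y] <-] := sorbit_of_surj b.
move=> [ab nobetw]; rewrite !odim_of /=.
have := odim_lt ab; rewrite !odim_of /= leq_eqVlt => /predU1P[//|pq].
have /sorbit_ofP[t /= tE] := ltW ab.
have [j nj] : exists j, ~ range t j.
  apply: contrapT => all_t.
  have [|h _] := @inj_factor q.+1 p.+1 q.+1 t (inj_id q.+1).
    by move=> i _; apply: contrapT => ni; apply: all_t; exists i.
  have := leq_card _ (@inj_inj _ _ h).
  by rewrite !card_ord ltnS leqNgt (ltn_trans _ pq).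
pose g (i : 'I_p.+2) := if unlift ord_max i is Some k then t k else j.
have gI : injectiveb (finfun g).
  apply/injectiveP => i k; rewrite !ffunE /g.
  case: unliftP => [i' ->|->]; case: unliftP => [k' ->|->] //.
  - by move=> /inj_inj ->.
  - by move=> tj; case: nj; exists i'.
  - by move=> tj; case: nj; exists k'.
have [|h hE] := @inj_factor _ _ _ (mk_inj gI) t.
  move=> _ [i _ <-]; exists (lift ord_max i) => //.
  by rewrite /inj_fun /= ffunE /g liftK.
exfalso; apply: (nobetw (sorbit_of (mk_simplex (res X (mk_inj gI) y)))).
split; rewrite lt_def; apply/andP; split.
- by apply/eqP => /(congr1 (@odim X)); rewrite !odim_of /= => /eqP; rewrite gtn_eqF.
- by apply/sorbit_ofP; exists h; rewrite /= -tE hE res_comp.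
- by apply/eqP => /(congr1 (@odim X)); rewrite !odim_of /= => /eqP; rewrite gtn_eqF.
- by apply/sorbit_ofP; exists (mk_inj gI).
Qed.

Lemma covered_of_dim (a b : sorbit X) :
  (a < b)%O -> odim b = (odim a).+1 -> covered_by a b.
Proof.
move=> ab abdim; split=> // c [/odim_lt ac /odim_lt].
by rewrite abdim ltnS leqNgt ac.
Qed.

(* Levels are ordered lexicographically, first by the dimension of the top of the
   matched pair (or of the critical orbit), then by the rank, critical orbits
   coming last. *)
Lemma matching_level (M : set (sorbit X * sorbit X)) :
  matching M -> acyclic_matching M ->
  exists l : sorbit X -> nat, (forall a b, M (a, b) -> l a = l b) /\
    forall x y, (x < y)%O -> ~ M (x, y) -> (l x < l y)%N.
Proof.
move=> mM acyc; have [Mcov _] := mM.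
have [h [B [hB hlt]]] := acyclic_rank (sorbit_finite finX) acyc.
(* [up] sends the lower half of a pair to the upper half and fixes all other orbits. *)
have /choice[up upP] (o : sorbit X) : exists u,
    (forall b, M (o, b) -> u = b) /\ ((forall b, ~ M (o, b)) -> u = o).
  have [[b Mob]|nM] := pselect (exists b, M (o, b)).
    exists b; split=> [b'|/(_ b)//]; exact: matching_lower_uniq.
  by exists o; split=> // b Mob; case: nM; exists b.
have upM a b : M (a, b) -> up a = b by case: (upP a) => + _; apply.
have upM' a b : M (a, b) -> up b = b.
  by case: (upP b) => _ + Mab; apply => c; exact: matching_no_chain Mab.
have up_dim o : (odim o <= odim (up o) <= (odim o).+1)%N /\
    (odim (up o) = (odim o).+1 -> M (o, up o)).
  have [[b Mob]|nM] := pselect (exists b, M (o, b)).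
    have := Mcov _ _ Mob => /covered_dim bE.
    by rewrite (upM _ _ Mob) bE leqnSn leqnn.
  have -> : up o = o by case: (upP o) => _; apply=> b Mob; apply: nM; exists b.
  by rewrite leqnn leqnSn; split=> // /eqP; rewrite ltn_eqF.
(* [B] exceeds every rank, which puts critical orbits last; as [k] takes values up to [B], [B.+1] is
   the base of the lexicographic encoding. *)
pose k o := if `[< matched M o >] then h (up o) else B.
have kB o : (k o < B.+1)%N.
  by rewrite /k; case: ifP => _; rewrite ltnS// ltnW.
exists (fun o => odim (up o) * B.+1 + k o)%N; split=> [a b Mab|x y xy nM].
  rewrite (upM _ _ Mab) (upM' _ _ Mab) /k; congr (_ + _)%N.
  rewrite (upM _ _ Mab) (upM' _ _ Mab) !asboolT//.
    by exists (a, b) => //; right.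
  by exists (a, b) => //; left.
have [/andP[x1 x2] xM] := up_dim x; have [/andP[y1 y2] yM] := up_dim y.
have xydim := odim_lt xy.
have [lt_up|] := ltnP (odim (up x)) (odim (up y)).
  apply: (@leq_trans ((odim (up x)).+1 * B.+1)%N).
    by rewrite mulSn addnC ltn_add2r.
  by apply: leq_trans (leq_addr _ _); rewrite leq_pmul2r.
(* The chain [odim x < odim y <= odim (up y) <= odim (up x) <= (odim x).+1] forces [x] to be the
   lower half of a pair, and [y] to be critical or the upper half of another. *)
move=> le_up; have yE : odim y = (odim x).+1 by lia.
have xE : odim (up x) = (odim x).+1 by lia.
have uyE : odim (up y) = odim y by lia.
rewrite uyE xE yE ltn_add2l.
have {}xM := xM xE; have mx : matched M x by exists (x, up x) => //; left.
rewrite /k asboolT//; case: asboolP => [[[a b] Mab yab]|_]; last exact: hB.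
have {yab} yb : y = b.
  case: yab => //= ya; have := Mcov _ _ Mab => /covered_dim.
  by rewrite -ya -(upM _ _ Mab) -ya uyE => /eqP; rewrite ltn_eqF.
rewrite yb (upM' _ _ Mab) -yb; apply: (hlt x) => //.
  exact: covered_of_dim.
by move=> upx; apply: nM; rewrite -upx.
Qed.

End Levels.

(** * Successive collapses *)

Section Reduction.
Variables (R : realType) (X : sym_delta_complex).
Hypothesis finX : finite_set [set: simplex X].
Variable M : set (sorbit X * sorbit X).
Hypotheses (mM : matching M) (acycM : acyclic_matching M).
Hypothesis permM : permissible_matching M.
Local Notation T := (realization R X).
Local Notation I := (`[0, 1]%classic : set R).
Implicit Types (D : set (sorbit X)) (f : T -> T).

Definition same_value f : rel T := fun x y => f x == f y.

Lemma same_value_refl f : reflexive (same_value f).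
Proof. by move=> x; exact: eqxx. Qed.

Lemma same_value_sym f : symmetric (same_value f).
Proof. by move=> x y; exact: eq_sym. Qed.

Lemma same_value_trans f : transitive (same_value f).
Proof. by move=> y x z /eqP xy /eqP yz; apply/eqP; rewrite xy. Qed.

Definition fibers f : equiv_rel T := EquivRel (same_value f)
  (same_value_refl f) (same_value_sym f) (same_value_trans (f := f)).

Lemma fibersP f x y : fibers f x y <-> f x = f y.
Proof. by split=> /eqP. Qed.

(* [f] is the (discontinuous) map performing all the collapses inside the
   subcomplex [D], one after the other. *)
Record reduction D f : Prop := Reduction {
  red_down : down_closed D;
  red_sat : forall a b, M (a, b) -> D a <-> D b;
  red_out : forall y, ~ D (carrier y) -> f y = y;
  red_in : forall y, D (carrier y) -> D (carrier (f y));
  red_unmatched : forall y, D (carrier y) -> ~ matched M (carrier (f y));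
  red_dim : forall y, (odim (carrier (f y)) <= odim (carrier y))%N;
  red_fixed : forall y, ~ matched M (carrier y) -> f y = y;
  red_closed : closed [set u : T * T | f u.1 = f u.2];
  red_equiv : homotopy_equivalent R T (quo (fibers f))
}.

Lemma reduction0 : reduction set0 id.
Proof.
split=> //; first exact/closed_diag/realization_hausdorff.
apply: quo_eq_homotopy_equivalent => x y; last by move/fibersP.
Qed.

(** [f] maps the subcomplex into itself and fixes every point outside, so it identifies nothing
    across. *)
Lemma red_eq D f x y : reduction D f -> f x = f y ->
  x = y \/ D (carrier x) /\ D (carrier y).
Proof.
move=> rf fxy; have [Dx|nDx] := pselect (D (carrier x)).
  have [Dy|nDy] := pselect (D (carrier y)); first by right.
  by exfalso; apply: (nDy); rewrite -(red_out rf nDy) -fxy; exact: red_in rf _ Dx.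
have fx := red_out rf nDx; left.
have [Dy|nDy] := pselect (D (carrier y)); last by rewrite -fx fxy (red_out rf).
by exfalso; apply: nDx; rewrite -fx fxy; exact: red_in rf _ Dy.
Qed.

(** No collapse takes place: [f] already fixes the points of an unmatched open cell. *)
Lemma reduction_critical D f o : reduction D f -> ~ D o ->
  ~ matched M o -> (forall o', (o' < o)%O -> D o') ->
  reduction (D `|` [set o]) f.
Proof.
move=> rf nDo nmo oD; have fo y : carrier y = o -> f y = y.
  by move=> yo; apply: (red_fixed rf); rewrite yo.
case: (rf) => Dd Dsat Dout Din Dum Ddim Dfix Dcl Deq; split=> //.
- exact: down_closedU1.
- move=> a b Mab; have [ao bo] : a <> o /\ b <> o.
    by split=> oE; apply: nmo; exists (a, b) => //; [left|right].
  by split=> -[/(Dsat _ _ Mab)|//]; left.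
- by move=> y nDy; apply: Dout => Dy; apply: nDy; left.
- by move=> y [/Din|/= yo]; [left|right; rewrite fo].
- by move=> y [/Dum//|/= yo]; rewrite fo ?yo.
Qed.

(** The new pair is pushed into [D] before the earlier collapses are applied: on the enlarged
    subcomplex, [f'] is [f] after the end map of [H]. *)
Lemma reduction_pair D f a b : reduction D f -> M (a, b) -> ~ D a -> ~ D b ->
  (forall o, (o < b)%O -> o <> a -> D o) ->
  exists f', reduction (D `|` [set a; b]) f'.
Proof.
move=> rf Mab nDa nDb bD; have [Mcov _] := mM.
have hT := realization_hausdorff finX (R := R).
have cT := realization_compact finX (R := R).
have mat_a : matched M a by exists (a, b) => //; left.
have mat_b : matched M b by exists (a, b) => //; right.
have [p [alpha [beta [aE bE]]]] : exists p (alpha : cells X p.+1)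
    (beta : cells X p.+2), a = sorbit_of (mk_simplex alpha) /\
      b = sorbit_of (mk_simplex beta).
  have := covered_dim (Mcov _ _ Mab).
  have [[p x] <-] := sorbit_of_surj a; have [[q y] <-] := sorbit_of_surj b.
  rewrite !odim_of /= => qp; case: _ / (esym qp) y => y.
  by exists p, x, y.
have perm : permissible_face alpha beta by apply: permM; rewrite -aE -bE.
rewrite aE in nDa bD; rewrite bE in nDb bD.
have [H [D'd Hc H0 HD HD']] := collapse_pair R finX perm (red_down rf) nDa nDb bD.
rewrite -aE -bE in D'd HD' nDa nDb; set D' := D `|` [set a; b] in D'd HD' *.
pose f' y := if pselect (D' (carrier y)) then f (H (y, 1)) else y.
have f'in y : D' (carrier y) -> f' y = f (H (y, 1)) by rewrite /f'; case: pselect.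
have f'out y : ~ D' (carrier y) -> f' y = y by rewrite /f'; case: pselect.
have t1 : 0 <= (1 : R) <= 1 by rewrite ler01 lexx.
have DD' o : D o -> D' o by left.
have f'D y : D (carrier y) -> f' y = f y by move=> Dy; rewrite f'in ?HD//; exact: DD'.
have f'D' y : D' (carrier y) -> D (carrier (f' y)).
  by move=> D'y; rewrite f'in//; apply: (red_in rf); have [] := HD' y 1 D'y t1.
have f'eq x y : f' x = f' y -> x = y \/ D' (carrier x) /\ D' (carrier y).
  move=> fxy; have [Dx|nDx] := pselect (D' (carrier x)).
    have [Dy|nDy] := pselect (D' (carrier y)); first by right.
    by exfalso; apply: (nDy); rewrite -(f'out _ nDy) -fxy; apply/DD'/f'D'.
  left; have [Dy|nDy] := pselect (D' (carrier y)).
    by exfalso; apply: (nDx); rewrite -(f'out _ nDx) fxy; apply/DD'/f'D'.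
  by rewrite -(f'out _ nDx) fxy f'out.
have H1c : continuous (fun y => H (y, 1)).
  apply/ccontT; apply: (@ccont_comp _ _ _ _ ([set: T] `*` I) (fun x => (x, 1))) => //.
  apply/ccontT; apply: continuous_pair; last exact: cst_continuous.
  by move=> x; exact: cvg_id.
have f'cl : closed [set u : T * T | f' u.1 = f' u.2].
  (* Although [f'] is discontinuous, its fibre relation is the diagonal together with a preimage of
     the old closed relation under the continuous end map, cut down to a closed subcomplex. *)
  rewrite (_ : mkset _ = [set u : T * T | u.1 = u.2] `|`
      ((@subreal R X D' `*` @subreal R X D') `&`
      (fun u => (H (u.1, 1), H (u.2, 1))) @^-1` [set u : T * T | f u.1 = f u.2])).
    apply: closedU; first exact: closed_diag.
    apply: closedI; first by apply: closed_setX; exact: subreal_closed.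
    apply: preimage_closed; last exact: red_closed rf.
    move=> u _; apply: continuous_pair => {}u.
      apply: (@continuous_comp _ _ _ fst (fun y => H (y, 1))); first exact: cvg_fst.
      exact: H1c.
    apply: (@continuous_comp _ _ _ snd (fun y => H (y, 1))); first exact: cvg_snd.
    exact: H1c.
  apply/seteqP; split=> [[x y] /= fxy|[x y] [/= ->//|[[/= Dx Dy] fxy]]].
    have [->|[Dx Dy]] := f'eq _ _ fxy; first by left.
    by right; split=> //=; rewrite -!f'in.
  by rewrite /= !f'in.
exists f'; split=> //.
- move=> c e Mce; have [ca|ca] := pselect (c = a).
    rewrite ca in Mce *; rewrite (matching_lower_uniq mM Mce Mab).
    by split=> _; right; [right|left].
  have eb : e <> b.
    move=> eb; apply: ca; rewrite eb in Mce.
    exact: (matching_upper_uniq mM Mce Mab).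
  have cb : c <> b.
    by move=> cb; rewrite cb in Mce; exact: (matching_no_chain mM Mab Mce).
  have ea : e <> a.
    by move=> ea; rewrite ea in Mce; exact: (matching_no_chain mM Mce Mab).
  by split=> -[/(red_sat rf Mce) ?|[]//]; left.
- by move=> y /f'D'; exact: DD'.
- move=> y D'y; rewrite f'in//; apply: (red_unmatched rf).
  by have [] := HD' y 1 D'y t1.
- move=> y; have [D'y|nD'y] := pselect (D' (carrier y)); last by rewrite f'out.
  rewrite f'in//; apply: leq_trans (red_dim rf _) _.
  by have [] := HD' y 1 D'y t1.
- move=> y nmy; have [D'y|/f'out//] := pselect (D' (carrier y)).
  have Dy : D (carrier y).
    by case: D'y => // -[] yE; rewrite yE in nmy.
  by rewrite f'D// (red_fixed rf).
apply: homotopy_equivalent_trans (red_equiv rf) _.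
apply: (@quo_homotopy_equivalent R T hT cT _ _ H) => //.
- rewrite (_ : mkset _ = [set u : T * T | f u.1 = f u.2]); first exact: red_closed rf.
  by apply/seteqP; split=> u /= /fibersP.
- rewrite (_ : mkset _ = [set u : T * T | f' u.1 = f' u.2])//.
  by apply/seteqP; split=> u /= /fibersP.
- move=> x y /fibersP fxy; apply/fibersP.
  by have [->//|[Dx Dy]] := red_eq rf fxy; rewrite !f'D.
- move=> x y t t01 /fibersP fxy; apply/fibersP.
  by have [->//|[Dx Dy]] := red_eq rf fxy; rewrite !HD.
- move=> x y t t01 /fibersP fxy; apply/fibersP.
  have [->//|[Dx Dy]] := f'eq _ _ fxy.
  (* Pushing for time [t] and then to the end is the same as pushing to the end, so the values of
     [f'] are unchanged. *)
  have [Dxt Hx _ _] := HD' x t Dx t01; have [Dyt Hy _ _] := HD' y t Dy t01.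
  by rewrite !f'in// in fxy *; rewrite Hx Hy.
move=> x y /fibersP fxy; apply/fibersP.
have [->//|[Dx Dy]] := f'eq _ _ fxy.
by rewrite -!f'in.
Qed.

Lemma reduction_exists : exists f, reduction setT f.
Proof.
have [l [lM llt]] := matching_level finX mM acycM.
suff: forall D f, reduction D f -> exists f', reduction setT f'.
  by apply; exact: reduction0.
apply: (superset_ind (sorbit_finite finX)) => D IH f rf.
have [[o0 nDo0]|allD] := pselect (exists o, ~ D o); last first.
  exists f; rewrite (_ : setT = D)//; apply/seteqP; split=> // o _.
  by apply: contrapT => nDo; apply: allD; exists o.
(* At least level, everything strictly below [o] or its pair, other than the pair itself, has
   smaller level and is already in [D]. *)
have [|o nDo omin] := @ex_minimal _ (fun o => ~ D o) l; first by exists o0.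
have Dl o' : (l o' < l o)%N -> D o'.
  by move=> oo'; apply: contrapT => /omin; rewrite leqNgt oo'.
have [[[a b] Mab oab]|nmo] := pselect (matched M o); last first.
  apply: (IH (D `|` [set o]) o _ _ nDo f).
  - by move=> z; left.
  - by right.
  apply: reduction_critical => // o' oo'; apply: Dl; apply: llt => // Mo'.
  by apply: nmo; exists (o', o) => //; right.
have [nDa nDb] : ~ D a /\ ~ D b.
  by case: oab => /= oE; rewrite oE in nDo; split=> // /(red_sat rf Mab).
have lo : l o = l b by case: oab => /= ->//; exact: lM.
have [|f' rf'] := reduction_pair rf Mab nDa nDb.
  move=> o' o'b o'a; apply: Dl; rewrite lo; apply: llt => // Mo'b.
  exact/o'a/(matching_upper_uniq mM Mo'b Mab).
apply: (IH (D `|` [set a; b]) a _ _ nDa f') => //.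
by right; left.
Qed.

End Reduction.

(** * The equivariant ball *)

Section SimplexFrame.
Variables (R : realType) (p : nat).
Local Notation r := (Num.sqrt p.+1%:R : R).
Local Notation J := (const_mx 1).

Lemma mul_const_mx m n k (a b : R) :
  (const_mx a : 'M_(m, n)) *m (const_mx b : 'M_(n, k)) = const_mx (n%:R * (a * b)).
Proof.
apply/matrixP => i j; rewrite !mxE.
under eq_bigr do rewrite !mxE.
by rewrite sumr_const card_ord mulr_natl.
Qed.

(* The rows are an orthonormal basis of the hyperplane of vectors with zero
   sum: they are the last rows of the Householder reflection exchanging the first
   basis vector with [- (1, ..., 1) / sqrt (p + 1)]. *)
Definition frame : 'M[R]_(p, 1 + p) :=
  row_mx (const_mx (- r^-1)) (1%:M - const_mx (p.+1%:R + r)^-1).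

Let r0 : 0 < r. Proof. by rewrite sqrtr_gt0 ltr0n. Qed.
Let rE : p.+1%:R = r ^+ 2. Proof. by rewrite sqr_sqrtr. Qed.
Let pE : p%:R = r ^+ 2 - 1. Proof. by rewrite -rE mulrSr addrK. Qed.

Let sq_center (c : R) : (1%:M - const_mx c : 'M_p) *m (1%:M - const_mx c) =
  1%:M + const_mx (p%:R * c ^+ 2 - 2 * c).
Proof.
rewrite mulmxBl mul1mx mulmxBr mulmx1 mul_const_mx.
by apply/matrixP => i j; rewrite !mxE; ring.
Qed.

Let tr_center (c : R) : (1%:M - const_mx c : 'M_p)^T = 1%:M - const_mx c.
Proof. by rewrite linearB/= trmx1 trmx_const. Qed.

Lemma frame_orthonormal : frame *m frame^T = 1%:M.
Proof.
rewrite /frame tr_row_mx tr_center trmx_const mul_row_col sq_center mul_const_mx.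
apply/matrixP => i j; rewrite !mxE; move: r r0 rE pE => x x0 xE xE'.
by rewrite xE xE'; field; rewrite !gt_eqF// addr_gt0// exprn_gt0.
Qed.

(** The right-hand side is the orthogonal projection onto the hyperplane of zero sum. *)
Lemma frame_projection :
  frame^T *m frame = 1%:M - const_mx p.+1%:R^-1 :> 'M_(1 + p).
Proof.
rewrite /frame tr_row_mx tr_center trmx_const mul_col_row sq_center.
rewrite mulmxBl mulmxBr mulmx1 mul1mx !mul_const_mx.
rewrite scalar_mx_block -block_mx_const opp_block_mx add_block_mx.
move: r r0 rE pE => x x0 xE xE'.
congr block_mx; apply/matrixP => i j; rewrite !mxE ?ord1 ?eqxx /= xE xE';
  by field; rewrite !gt_eqF// ?addr_gt0// ?exprn_gt0.
Qed.

Lemma frame_sum0 : frame *m (J : 'M_(1 + p, 1)) = 0.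
Proof.
rewrite -[LHS]mul1mx -frame_orthonormal -!mulmxA [_ *m (_ *m J)]mulmxA.
rewrite frame_projection mulmxBl mul1mx mul_const_mx mulr1.
by rewrite [_ / _]divff ?pnatr_eq0// subrr mulmx0.
Qed.

End SimplexFrame.

Section OrthogonalRepresentation.
Variables (R : realType) (p : nat).
Local Notation Q := (frame R p).
Implicit Types (s t : 'S_p.+1).

(** The permutation action on the hyperplane of zero sum, in the coordinates of the frame. *)
Definition orth_mx s : 'M[R]_p := Q *m (perm_mx s : 'M_(1 + p)) *m Q^T.

(** Permutations fix the all-ones vector and the frame kills it, so the projection [Q^T *m Q] may be
    dropped. Multiplicativity of [orth_mx] follows. *)
Lemma frame_perm s :
  Q *m (perm_mx s : 'M_(1 + p)) *m Q^T *m Q = Q *m perm_mx s.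
Proof.
rewrite -mulmxA frame_projection mulmxBr mulmx1 -[RHS]subr0; congr (_ - _).
have -> : const_mx p.+1%:R^-1 =
    (const_mx 1 : 'M_(1 + p, 1)) *m (const_mx p.+1%:R^-1 : 'M_(1, 1 + p))
    :> 'M[R]_(1 + p).
  by rewrite mul_const_mx !mul1r.
have perm_const : (perm_mx s : 'M_(1 + p)) *m (const_mx 1 : 'M_(1 + p, 1)) =
    const_mx 1 :> 'M[R]_(_, _).
  by rewrite -row_permE; apply/matrixP => i j; rewrite !mxE.
by rewrite -mulmxA [perm_mx s *m _]mulmxA perm_const mulmxA frame_sum0 mul0mx.
Qed.

Lemma orth_mx1 : orth_mx 1%g = 1%:M.
Proof. by rewrite /orth_mx perm_mx1 mulmx1 frame_orthonormal. Qed.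

Lemma orth_mxM s t : orth_mx (s * t)%g = orth_mx s *m orth_mx t.
Proof.
by rewrite /orth_mx perm_mxM !mulmxA frame_perm -!mulmxA.
Qed.

Lemma orth_mx_tr s : (orth_mx s)^T = orth_mx s^-1.
Proof. by rewrite /orth_mx !trmx_mul trmxK tr_perm_mx mulmxA. Qed.

Lemma orth_mx_orth s : (orth_mx s)^T *m orth_mx s = 1%:M.
Proof. by rewrite orth_mx_tr -orth_mxM mulVg orth_mx1. Qed.

Lemma orth_mx_inv s : invmx (orth_mx s) = orth_mx s^-1.
Proof.
have [_ u] := mulmx1_unit (orth_mx_orth s).
by rewrite -[LHS]mul1mx -(orth_mx_orth s) mulmxK// orth_mx_tr.
Qed.

(** From [Q *m perm_mx s] one recovers [perm_mx s] minus a constant matrix that does not depend on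
    [s]. *)
Lemma orth_mx_inj : injective orth_mx.
Proof.
move=> s t st; have {}st : Q *m (perm_mx s : 'M_(1 + p)) = Q *m (perm_mx t : 'M_(1 + p)).
  by rewrite -(frame_perm s) -(frame_perm t) -/(orth_mx s) -/(orth_mx t) st.
have : (perm_mx s : 'M[R]_(1 + p)) = perm_mx t.
  have := congr1 (mulmx Q^T) st.
  rewrite [LHS]mulmxA [RHS]mulmxA frame_projection [LHS]mulmxBl [RHS]mulmxBl.
  rewrite [_%:M *m perm_mx s]mul1mx [_%:M *m perm_mx t]mul1mx.
  have const_perm u :
      (const_mx p.+1%:R^-1 : 'M[R]_(1 + p)) *m perm_mx u = const_mx p.+1%:R^-1.
    apply/matrixP => i j; rewrite !mxE (bigD1 (u^-1 j)%g)//= big1 => [|k kj].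
      by rewrite !mxE permKV eqxx mulr1 addr0.
    by rewrite !mxE -(inj_eq (@perm_inj _ u^-1%g)) permK (negbTE kj) mulr0.
  by rewrite (const_perm s) (const_perm t) => /addIr.
move=> /matrixP st'; apply/permP => i; have := st' i (s i).
by rewrite !mxE eqxx; case: eqP => [->//|_] /eqP; rewrite oner_eq0.
Qed.

Variable H : {group 'S_p.+1}.

Definition orth_set : set 'M[R]_p := [set orth_mx s | s in [set` H]].

Lemma orth_set_finite : finite_set orth_set.
Proof. exact/finite_image/finite_finset. Qed.

Lemma orth_set_orth A : orth_set A -> A^T *m A = 1%:M.
Proof. by move=> [s _ <-]; exact: orth_mx_orth. Qed.

Lemma orth_set1 : orth_set 1%:M.
Proof. by exists 1%g; [exact: group1|exact: orth_mx1]. Qed.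

Lemma orth_setM A B : orth_set A -> orth_set B -> orth_set (A *m B).
Proof.
move=> [s /= sH <-] [t /= tH <-]; exists (s * t)%g; last exact: orth_mxM.
exact: groupM.
Qed.

Lemma orth_setV A : orth_set A -> orth_set (invmx A).
Proof.
move=> [s /= sH <-]; exists s^-1%g; last by rewrite orth_mx_inv.
by rewrite /= groupV.
Qed.

Definition orth_group : fin_orth_group R p := FinOrthGroup
  orth_set_finite orth_set_orth orth_set1 orth_setM orth_setV.

End OrthogonalRepresentation.

(* Uniqueness of the point mapped to a given one on a given ray. *)
Lemma radial_scale_eq1 (R : realType) (k X m n : R) : 0 < k -> 0 <= X ->
  - (n * (k * m + 0)) + 1 - k ^+ 2 * X = k * (- (n * m) + 1 - X) -> k = 1.
Proof.
move=> k0 X0 E; have /eqP : (1 - k) * (1 + k * X) = 0 by nra.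
by rewrite mulf_eq0 => /orP[|] /eqP; nra.
Qed.

(** Existence of the point mapped to a given one on a given ray: [k] is the factor by which the
    direction vector is scaled. *)
Lemma radial_root (R : realType) (e Z : R) : 0 <= e -> 0 <= Z -> e + Z != 0 ->
  exists2 k, 0 < k & Z * k ^+ 2 + e * k = 1.
Proof.
move=> e0 Z0 eZ; pose S := Num.sqrt (e ^+ 2 + 4 * Z).
have S0 : 0 <= S by exact: sqrtr_ge0.
have S2 : S ^+ 2 = e ^+ 2 + 4 * Z.
  by rewrite sqr_sqrtr// addr_ge0 ?sqr_ge0// mulr_ge0.
have eS : 0 < e + S.
  rewrite lt_def addr_ge0// andbT; apply: contraNneq eZ => eS0.
  have e00 : e = 0 by lra.
  have S00 : S = 0 by lra.
  by apply/eqP; move: S2; rewrite S00 e00; lra.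
(* The positive root of [Z k^2 + e k = 1], written without dividing by [Z]. *)
exists (2 / (e + S)); first by rewrite divr_gt0.
have -> : Z = (S ^+ 2 - e ^+ 2) / 4 by rewrite S2; field.
by field; rewrite gt_eqF.
Qed.

(** * The equivariant map from the ball to the simplex *)

Section BallToSimplex.
Variables (R : realType) (p : nat).
Local Notation Q := (frame R p : 'M_(p, p.+1)).
Local Notation simp := (std_simplex R p).
Local Notation c := (barycenter R p).
Implicit Types (x : 'cV[R]_p) (z : 'rV[R]_p.+1).

Lemma sqnormE x : sqnorm x = (x^T *m x) ord0 ord0.
Proof. by rewrite mxE; apply: eq_bigr => i _; rewrite mxE expr2. Qed.

Lemma sqnormZ k x : sqnorm (k *: x) = k ^+ 2 * sqnorm x.
Proof. by rewrite mulr_sumr; apply: eq_bigr => i _; rewrite mxE exprMn. Qed.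

Lemma sqnorm_continuous : continuous (@sqnorm R p).
Proof.
rewrite (_ : @sqnorm R p = fun x : 'cV[R]_p => \sum_i x i ord0 * x i ord0).
  by apply: rcont_sum => i; apply: rcontM; exact: coord_continuous.
by apply/funext => x; apply: eq_bigr => i _; rewrite expr2.
Qed.

Lemma sqnorm_ge0 x : 0 <= sqnorm x.
Proof. by apply: sumr_ge0 => i _; exact: sqr_ge0. Qed.

Lemma sqnorm_eq0 x : sqnorm x = 0 -> x = 0.
Proof.
move=> /eqP; rewrite psumr_eq0 => [/allP x0|i _]; last exact: sqr_ge0.
apply/colP => i; have := x0 i (mem_index_enum i).
by rewrite sqrf_eq0 mxE => /eqP.
Qed.

Lemma sqnorm_orth (s : 'S_p.+1) x : sqnorm (orth_mx R s *m x) = sqnorm x.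
Proof.
rewrite !sqnormE; set A := orth_mx R s.
have -> : (A *m x)^T *m (A *m x) = x^T *m (A^T *m A) *m x.
  by rewrite trmx_mul !mulmxA.
by rewrite orth_mx_orth mulmx1.
Qed.

Lemma mincoord_sum0 z : \sum_i z ord0 i = 0 -> mincoord z <= 0.
Proof.
move=> z0; rewrite leNgt; apply/negP => mz.
have : 0 < \sum_i z ord0 i.
  rewrite (bigD1 ord0)//= ltr_pwDl//; first exact: lt_le_trans (mincoord_le _ _).
  by apply: sumr_ge0 => i _; apply: ltW; exact: lt_le_trans (mincoord_le _ _).
by rewrite z0 ltxx.
Qed.

Lemma mincoord_sum0_eq0 z : \sum_i z ord0 i = 0 -> 0 <= mincoord z -> z = 0.
Proof.
move=> z0 mz; have zi i : 0 <= z ord0 i := le_trans mz (mincoord_le z i).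
move: z0 => /eqP; rewrite psumr_eq0// => /allP z0.
apply/rowP => i; have := z0 i (mem_index_enum i).
by rewrite mxE => /eqP.
Qed.

Lemma mincoord_scale_shift k b z : 0 <= k ->
  mincoord (k *: z + const_mx b) = k * mincoord z + b.
Proof.
move=> k0; apply: mincoordP => [i|].
  by rewrite !mxE lerD2r ler_wpM2l// mincoord_le.
by have [i ->] := mincoord_ex z; exists i; rewrite !mxE.
Qed.

(** The isometry with the hyperplane of zero sum, written in row vectors. *)
Definition ball_vec x : 'rV[R]_p.+1 := x^T *m Q.

Lemma ball_vec_sum0 x : \sum_i ball_vec x ord0 i = 0.
Proof.
have : (ball_vec x *m (const_mx 1 : 'cV_(1 + p))) ord0 ord0 = 0.
  by rewrite -mulmxA frame_sum0 mulmx0 mxE.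
rewrite mxE => sum0; rewrite -[RHS]sum0.
by apply: eq_bigr => i _; rewrite [const_mx _ _ _]mxE mulr1.
Qed.

Lemma ball_vec_inj : injective ball_vec.
Proof.
move=> x y /(congr1 (mulmx^~ Q^T)); rewrite -!mulmxA frame_orthonormal !mulmx1.
exact: trmx_inj.
Qed.

Lemma ball_vecZ k x : ball_vec (k *: x) = k *: ball_vec x.
Proof. by rewrite /ball_vec linearZ/= -scalemxAl. Qed.

Lemma ball_vec0 : ball_vec 0 = 0.
Proof. by rewrite /ball_vec trmx0 mul0mx. Qed.

(* Along a ray, the gauge [mu / (mu + 1 - |x|^2)] of the image increases from [0]
   to [1], where [mu] is the gauge of [ball_vec x]. The [Num.min] only matters
   outside the ball, where it keeps the denominator positive. *)
Definition ball_den x : R :=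
  - (p.+1%:R * mincoord (ball_vec x)) + 1 - Num.min 1 (sqnorm x).

Definition ball_simp x : 'rV[R]_p.+1 := (ball_den x)^-1 *: ball_vec x + c.

(** The least coordinate of a vector of zero sum is nonpositive, and zero only for the zero vector.
    So the first term is positive wherever [1 - |x|^2] fails to be. *)
Lemma ball_den_gt0 x : 0 < ball_den x.
Proof.
have m0 := mincoord_sum0 (ball_vec_sum0 x).
have n0 : 0 < p.+1%:R :> R by rewrite ltr0n.
rewrite /ball_den; have [lt1|ge1] := ltP (sqnorm x) 1.
  by move: (p.+1%:R) n0 => n n0; nra.
rewrite addrK oppr_gt0 pmulr_rlt0// lt_neqAle m0 andbT.
apply: contraTneq ge1 => m0'; rewrite -ltNge.
have /ball_vec_inj -> : ball_vec x = ball_vec 0.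
  by rewrite ball_vec0; apply: mincoord_sum0_eq0; [exact: ball_vec_sum0|rewrite m0'].
by rewrite -(scale0r 0) sqnormZ expr0n mul0r ltr01.
Qed.

Lemma ball_simpE x i : ball_simp x ord0 i =
  (ball_den x)^-1 * ball_vec x ord0 i + p.+1%:R^-1.
Proof. by rewrite mxE [X in X + _]mxE [X in _ + X]mxE. Qed.

Lemma ball_simp_sum x : \sum_i ball_simp x ord0 i = 1.
Proof.
under eq_bigr do rewrite ball_simpE.
rewrite big_split/= -mulr_sumr ball_vec_sum0 mulr0 add0r sumr_const card_ord.
by rewrite -[_ *+ _]mulr_natl divff// pnatr_eq0.
Qed.

(** Membership in the simplex, and the matching of interior with interior, are both read off from
    this formula. *)
Lemma mincoord_ball_simp x : sqnorm x <= 1 ->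
  mincoord (ball_simp x) = (1 - sqnorm x) / (p.+1%:R * ball_den x).
Proof.
move=> x1; have d0 := ball_den_gt0 x.
rewrite mincoord_scale_shift ?invr_ge0 1?ltW//.
have n0 : 0 < p.+1%:R :> R by rewrite ltr0n.
have : ball_den x = - (p.+1%:R * mincoord (ball_vec x)) + 1 - sqnorm x.
  by rewrite /ball_den (min_idPr x1).
move: (ball_den x) d0 (p.+1%:R) n0 => d d0 n n0 dE.
apply: (@mulfI _ (n * d)); first by rewrite mulf_neq0// gt_eqF.
rewrite [RHS]mulrC divfK ?mulf_neq0 ?gt_eqF//.
move: (mincoord _) dE => m dE; have -> : n * d * (d^-1 * m + n^-1) = n * m + d.
  by field; rewrite !gt_eqF.
by rewrite dE; ring.
Qed.

Lemma ball_simp_in x : sqnorm x <= 1 -> simp (ball_simp x).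
Proof.
move=> x1; split; last exact: ball_simp_sum.
move=> i; apply: le_trans (mincoord_le _ i); rewrite mincoord_ball_simp//.
by rewrite divr_ge0 ?subr_ge0// mulr_ge0// ltW// ball_den_gt0.
Qed.

Lemma ball_simp_pos x : sqnorm x <= 1 ->
  positive (ball_simp x) <-> sqnorm x < 1.
Proof.
move=> x1; have nd : 0 < (p.+1%:R * ball_den x)^-1.
  by rewrite invr_gt0 mulr_gt0 ?ltr0n// ball_den_gt0.
split=> [pos|lt1 i].
  have [i iE] := mincoord_ex (ball_simp x).
  by have := pos i; rewrite -iE mincoord_ball_simp// pmulr_lgt0// subr_gt0.
apply: lt_le_trans (mincoord_le _ i); rewrite mincoord_ball_simp//.
by rewrite pmulr_lgt0// subr_gt0.
Qed.

(** Equal images force [y] to be a positive multiple of [x], and on one ray the scale factor is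
    determined. *)
Lemma ball_simp_inj x y : sqnorm x <= 1 -> sqnorm y <= 1 ->
  ball_simp x = ball_simp y -> x = y.
Proof.
move=> x1 y1 /addIr xy; have dx := ball_den_gt0 x; have dy := ball_den_gt0 y.
pose k := ball_den y / ball_den x; have k0 : 0 < k by rewrite divr_gt0.
have {}xy : y = k *: x.
  apply: ball_vec_inj; rewrite ball_vecZ -scalerA xy scalerA divff ?gt_eqF//.
  by rewrite scale1r.
have kE : ball_den y = k * ball_den x by rewrite divfK// gt_eqF.
have vE : ball_vec y = k *: ball_vec x + const_mx 0.
  by rewrite xy ball_vecZ; apply/matrixP => i j; rewrite !mxE addr0.
move: kE; rewrite /ball_den (min_idPr x1) (min_idPr y1) vE.
rewrite mincoord_scale_shift ?(ltW k0)// [in sqnorm y]xy sqnormZ.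
move=> /(radial_scale_eq1 k0 (sqnorm_ge0 x)) k1.
by rewrite xy k1 scale1r.
Qed.

Lemma ball_simp_surj a : simp a -> exists2 x, sqnorm x <= 1 & ball_simp x = a.
Proof.
move=> pa; have [a0 a1] := pa; pose z := a - c; pose w := (z *m Q^T)^T.
have z0 : \sum_i z ord0 i = 0.
  under eq_bigr do rewrite mxE [X in _ + X]mxE [X in - X]mxE.
  rewrite sumrB a1 sumr_const card_ord.
  by rewrite -[_ *+ _]mulr_natl divff ?subrr// pnatr_eq0.
have wz : ball_vec w = z.
  rewrite /ball_vec trmxK -mulmxA frame_projection mulmxBr mulmx1.
  rewrite (_ : z *m _ = 0) ?subr0//; apply/rowP => j; rewrite !mxE.
  under eq_bigr do rewrite [const_mx _ _ _]mxE.
  by rewrite -mulr_suml z0 mul0r.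
have n0 : 0 < p.+1%:R :> R by rewrite ltr0n.
have aE : a = 1 *: z + const_mx p.+1%:R^-1 by rewrite scale1r subrK.
have mE : mincoord z = mincoord a - p.+1%:R^-1.
  by rewrite [in RHS]aE mincoord_scale_shift// mul1r addrK.
pose e := p.+1%:R * mincoord a; pose Z := sqnorm w.
have Z0 : 0 <= Z by exact: sqnorm_ge0.
have e0 : 0 <= e.
  by apply: mulr_ge0; [exact: ltW|have [i ->] := mincoord_ex a].
have eZ : e + Z != 0.
  rewrite paddr_eq0//; apply/negP => /andP[/eqP e00 /eqP/sqnorm_eq0 w0].
  have z00 : z = 0 by rewrite -wz w0 ball_vec0.
  have : mincoord z = 0.
    by apply: mincoordP => [i|]; [|exists ord0]; rewrite z00 mxE.
  rewrite mE => /eqP; rewrite subr_eq0 => /eqP ma.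
  by move: e00; rewrite /e ma divff ?gt_eqF// => /eqP; rewrite oner_eq0.
(* The equation for [k] says [ball_den (k *: w) = k], so the denominator cancels the scaling and
   leaves [z]. *)
have [k k0 kE] := radial_root e0 Z0 eZ.
have x1 : sqnorm (k *: w) <= 1.
  by rewrite sqnormZ -/Z -kE mulrC lerDl mulr_ge0// ltW.
exists (k *: w) => //.
have dk : ball_den (k *: w) = k.
  rewrite /ball_den (min_idPr x1) ball_vecZ wz sqnormZ -/Z.
  have -> : k *: z = k *: z + const_mx 0 by apply/rowP => i; rewrite !mxE addr0.
  rewrite mincoord_scale_shift ?ltW// addr0 mE.
  have -> : p.+1%:R * (k * (mincoord a - p.+1%:R^-1)) = k * e - k.
    by rewrite /e; move: (p.+1%:R) n0 => n n0; field; rewrite gt_eqF.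
  by rewrite -[X in _ + X - _]kE; ring.
by rewrite /ball_simp dk ball_vecZ wz scalerA mulVf ?gt_eqF// scale1r subrK.
Qed.

Lemma push_row_perm n (s : 'S_n) (a : 'rV[R]_n) :
  push_row (inj_of_perm s) a = a *m perm_mx s.
Proof.
apply/rowP => j; rewrite !mxE big_mkcond/=; apply: eq_bigr => i _.
by rewrite !mxE inj_of_permE; case: eqP => _; rewrite ?mulr1 ?mulr0.
Qed.

(** The inverse arises because [orth_mx s] acts on columns from the left, whereas the transposed row
    is multiplied from the right. *)
Lemma ball_simp_perm (s : 'S_p.+1) x :
  ball_simp (orth_mx R s *m x) = push_row (inj_of_perm s^-1) (ball_simp x).
Proof.
have vE : ball_vec (orth_mx R s *m x) = push_row (inj_of_perm s^-1) (ball_vec x).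
  rewrite push_row_perm /ball_vec trmx_mul orth_mx_tr.
  by rewrite -[LHS]mulmxA frame_perm mulmxA.
have dE : ball_den (orth_mx R s *m x) = ball_den x.
  by rewrite /ball_den vE mincoord_push sqnorm_orth.
apply: push_rowP => [i|j jn]; first by rewrite !ball_simpE vE dE push_rowE.
by have [i ij] := inj_endo_surj (inj_of_perm s^-1) j; case: jn; exists i.
Qed.

Lemma ball_simp_continuous : continuous ball_simp.
Proof.
have vc j : continuous (fun x => ball_vec x ord0 j).
  rewrite (_ : (fun _ => _) = fun x : 'cV[R]_p => \sum_i x i ord0 * Q i j).
    apply: rcont_sum => i; apply: rcontM; last exact: cst_continuous.
    exact: coord_continuous.
  by apply/funext => x; rewrite mxE; apply: eq_bigr => i _; rewrite mxE.
have dc : continuous ball_den.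
  apply: rcontD; [apply: rcontD; last exact: cst_continuous|].
    apply: rcontN; apply: rcontM; first exact: cst_continuous.
    move=> x; apply: (@continuous_comp _ _ _ ball_vec (@mincoord R p)).
      exact: rV_continuous.
    exact: mincoord_continuous.
  apply: rcontN; apply: rcont_min; first exact: cst_continuous.
  exact: sqnorm_continuous.
apply: rV_continuous => j; rewrite (_ : (fun _ => _) =
    fun x => (ball_den x)^-1 * ball_vec x ord0 j + p.+1%:R^-1).
  apply: rcontD; last exact: cst_continuous.
  apply: rcontM => //; apply: rcontV => // x.
  by rewrite gt_eqF// ball_den_gt0.
by apply/funext => x; rewrite ball_simpE.
Qed.

End BallToSimplex.

(** * The symmetric CW structure *)

Lemma set_type_compact (T : topologicalType) (A : set T) :
  A !=set0 -> compact A -> compact [set: A].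
Proof.
move=> [a0 Aa0] cA; pose f : T -> A := insubd (SigSub (mem_set Aa0) : A).
rewrite (_ : [set: A] = f @` A); last first.
  apply/seteqP; split=> // x _; exists (val x); last exact: valKd.
  by case: x => x /= /set_mem.
apply: continuous_compact => //; apply/subspace_sigL_continuousP.
rewrite (_ : sigL _ _ = id); first by move=> x; exact: cvg_id.
by apply/funext => x; exact: valKd.
Qed.

Lemma unit_ball_compact (R : realType) p : compact (unit_ball R p).
Proof.
(* The transposed ball is a closed subset of a compact box of row vectors. *)
pose B := [set z : 'rV[R]_p | \sum_i z ord0 i * z ord0 i <= 1].
have cB : compact B.
  apply: (subclosed_compact _ (@rV_compact R p (fun=> `[(-1), 1]%classic) _)).
  - apply: closed_le_fun; last exact: cst_continuous.
    by apply: rcont_sum => i; apply: rcontM; exact: coord_continuous.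
  - by move=> i; exact: segment_compact.
  move=> z /= zB i; rewrite /= in_itv/= -ler_norml -(@ler_pXn2r _ 2)// ?nnegrE//.
  rewrite expr1n real_normK ?num_real// expr2; apply: le_trans zB.
  by rewrite (bigD1 i)//= lerDl; apply: sumr_ge0 => j _; rewrite -expr2 sqr_ge0.
rewrite (_ : unit_ball R p = trmx @` B).
  apply: continuous_compact => //; apply: continuous_subspaceT.
  apply: cV_continuous => j; rewrite (_ : (fun _ => _) = fun z : 'rV[R]_p => z ord0 j).
    exact: coord_continuous.
  by apply/funext => z; rewrite mxE.
have trE (z : 'rV[R]_p) : sqnorm z^T = \sum_i z ord0 i * z ord0 i.
  by apply: eq_bigr => i _; rewrite mxE expr2.
apply/seteqP; split=> [x x1|_ [z zB <-]]; last by rewrite /unit_ball/= trE.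
by exists x^T; rewrite ?trmxK// /B /= -trE trmxK.
Qed.

Lemma sqnorm0 (R : realType) p : sqnorm (0 : 'cV[R]_p) = 0.
Proof. by rewrite /sqnorm big1// => i _; rewrite mxE expr0n. Qed.

Lemma unit_ball0 (R : realType) p : unit_ball R p 0.
Proof. by rewrite /unit_ball /= sqnorm0 ler01. Qed.

Section BallQuotient.
Variables (R : realType) (p : nat) (G : fin_orth_group R p).

Lemma ball_piP v w : ball_pi G v = ball_pi G w <-> ball_rel G v w.
Proof.
by split=> [/(@eqmodP _ (ball_equiv G))|vw]; last exact/(@eqmodP _ (ball_equiv G)).
Qed.

Lemma ball_pi_repr z : ball_pi G (generic_quotient.repr z) = z.
Proof. exact: reprK. Qed.

Lemma ball_pi_surj z : exists v, ball_pi G v = z.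
Proof. by exists (generic_quotient.repr z); exact: ball_pi_repr. Qed.

Lemma ball_pi_continuous : continuous (ball_pi G).
Proof. exact: pi_continuous. Qed.

Lemma ball_quot_continuous (S : topologicalType) (g : ball_quot G -> S) :
  continuous (g \o ball_pi G) -> continuous g.
Proof. by move=> gc; apply/quotient_continuous. Qed.

Lemma closed_ball_quot (C : set (ball_quot G)) :
  closed (ball_pi G @^-1` C) -> closed C.
Proof. by rewrite -!openC. Qed.

End BallQuotient.

Section SimplexAutomorphisms.
Variable X : sym_delta_complex.

Lemma inj_of_permM n (s t : 'S_n) :
  inj_of_perm (s * t)%g = inj_comp (inj_of_perm t) (inj_of_perm s).
Proof. by apply: inj_ext => i; rewrite inj_compE !inj_of_permE permM. Qed.

Lemma inj_of_perm1 n : inj_of_perm (1 : 'S_n)%g = inj_id n.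
Proof. by apply: inj_ext => i; rewrite inj_of_permE inj_idE perm1. Qed.

Lemma simplex_autP p (x : cells X p.+1) s :
  reflect (res X (inj_of_perm s) x = x) (s \in simplex_aut x).
Proof. by rewrite inE; exact: eqP. Qed.

Lemma simplex_aut_group_set p (x : cells X p.+1) : group_set (simplex_aut x).
Proof.
apply/group_setP; split=> [|s t /simplex_autP sx /simplex_autP tx].
  by apply/simplex_autP; rewrite inj_of_perm1 res_id.
by apply/simplex_autP; rewrite inj_of_permM res_comp tx.
Qed.

Definition aut_group p (x : cells X p.+1) : {group 'S_p.+1} :=
  Group (simplex_aut_group_set x).

(** Simplices of one orbit differ by a permutation [rho], and conjugation by [rho] carries one
    automorphism group onto the other. *)
Lemma orbit_group_isomorphic (R : realType) (s t : simplex X) :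
  sorbit_of s = sorbit_of t -> tag s = tag t /\
  group_isomorphic (orth_group R (aut_group (tagged s))) (simplex_aut (tagged t)).
Proof.
move=> st; have : orbit_set s t.
  have := congr1 val st; rewrite /= => ->; exact: orbit_set_refl.
case: s st => p x _ [rho _ <-]; split=> //=.
exists (fun u => orth_mx R (u ^ rho)%g); last first.
  by move=> u w _ _; rewrite conjMg orth_mxM.
have autJ u : (u \in simplex_aut (res X (inj_of_perm rho) x)) =
    (u ^ rho \in simplex_aut x)%g.
  apply/simplex_autP/simplex_autP => uE.
    rewrite !inj_of_permM !res_comp uE -res_comp -inj_of_permM mulVg.
    by rewrite inj_of_perm1 res_id.
  rewrite -[in RHS]uE -!res_comp -!inj_of_permM conjgE; congr res; congr inj_of_perm.
  by rewrite !mulgA mulgV mul1g.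
split.
- by move=> u /= ux; exists (u ^ rho)%g => //=; rewrite -autJ.
- by move=> u w _ _ /orth_mx_inj/conjg_inj.
- move=> _ [u /= ux <-]; exists (u ^ rho^-1)%g; last by rewrite conjgKV.
  by rewrite /= autJ conjgKV.
Qed.

End SimplexAutomorphisms.

(** * The cells of the last quotient *)

Section CriticalCells.
Variables (R : realType) (X : sym_delta_complex).
Hypothesis finX : finite_set [set: simplex X].
Variable M : set (sorbit X * sorbit X).
Local Notation T := (realization R X).
Variable f : T -> T.
Hypothesis redf : reduction M setT f.
Local Notation Y := (quo (fibers f)).
Local Notation simp p := (std_simplex R p).

Lemma morse_hausdorff : hausdorff_space Y.
Proof.
apply: quo_hausdorff; [exact: realization_hausdorff|exact: realization_compact|].
rewrite (_ : mkset _ = [set u : T * T | f u.1 = f u.2]); first exact: red_closed redf.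
by apply/seteqP; split=> u /= /fibersP.
Qed.

(** [f] is constant on each class and its value lies in an open critical cell, which is the cell of
    the class. *)
Definition morse_carrier (z : Y) : sorbit X :=
  carrier (f (generic_quotient.repr z)).

Lemma morse_carrierE y : morse_carrier (proj (fibers f) y) = carrier (f y).
Proof. by congr carrier; apply/fibersP; exact: proj_repr. Qed.

Lemma morse_carrier_unmatched z : ~ matched M (morse_carrier z).
Proof. exact: (red_unmatched redf). Qed.

Definition critical_cell o : set Y := [set z | morse_carrier z = o].

Lemma critical_cell_rep z : exists y, [/\ proj (fibers f) y = z, f y = y &
  carrier y = morse_carrier z].
Proof.
have [y <-] := proj_surj z; rewrite morse_carrierE.
have ffy : f (f y) = f y by apply: (red_fixed redf); exact: (red_unmatched redf).
by exists (f y); split=> //; apply/projP/fibersP.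
Qed.

Section CharacteristicMap.
Variables (p : nat) (x : cells X p.+1).
Local Notation G := (orth_group R (aut_group x)).
Variables (o : sorbit X) (xo : sorbit_of (mk_simplex x) = o).

Definition ball_map (v : unit_ball R p) : Y :=
  proj (fibers f) (chi x (ball_simp (val v))).

Lemma unit_ballP (v : unit_ball R p) : sqnorm (val v) <= 1.
Proof. by case: v => v /= /set_mem. Qed.

Lemma ball_map_equiv (v w : unit_ball R p) : ball_rel G v w -> ball_map v = ball_map w.
Proof.
move=> /asboolP[_ [s sx <-] wE]; rewrite /ball_map wE ball_simp_perm.
rewrite chi_push; last exact/ball_simp_in/unit_ballP.
by have /simplex_autP -> : s^-1%g \in aut_group x by rewrite groupV.
Qed.

Definition char_map (z : ball_quot G) : Y := ball_map (generic_quotient.repr z).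

Lemma char_mapE v : char_map (ball_pi G v) = ball_map v.
Proof. by apply: ball_map_equiv; apply/ball_piP; exact: ball_pi_repr. Qed.

Lemma char_map_continuous : continuous char_map.
Proof.
apply: ball_quot_continuous.
rewrite (_ : _ \o _ = ball_map); last by apply/funext => v; exact: char_mapE.
pose g (a : 'cV[R]_p) := proj (fibers f) (chi x (ball_simp a)).
have -> : ball_map = sigL (unit_ball R p) g by [].
have cB : closed (unit_ball R p).
  apply: compact_closed; last exact: unit_ball_compact.
  exact: norm_hausdorff.
apply/subspace_sigL_continuousP/ccontP => //.
apply: (@ccont_comp _ _ _ _ setT (fun a => chi x (ball_simp a)) (proj _)) => //.
  apply: (@ccont_comp _ _ _ _ (simp p) (@ball_simp R p) (chi x)) => //.
  - by move=> a; exact: ball_simp_in.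
  - by apply: continuous_ccont => //; exact: ball_simp_continuous.
  - exact: chi_ccont.
by apply/ccontT; exact: proj_continuous.
Qed.

Lemma ball_quot_compact : compact [set: ball_quot G].
Proof.
rewrite (_ : [set: _] = ball_pi G @` [set: unit_ball R p]).
  apply: continuous_compact; first exact/continuous_subspaceT/ball_pi_continuous.
  apply: set_type_compact; last exact: unit_ball_compact.
  by exists 0; exact: unit_ball0.
by apply/seteqP; split=> // z _; have [v <-] := ball_pi_surj z; exists v.
Qed.

Lemma char_map_closed D : closed D -> closed (char_map @` D).
Proof.
move=> cD; apply: compact_closed; first exact: morse_hausdorff.
apply: continuous_compact; first exact/continuous_subspaceT/char_map_continuous.
by apply: subclosed_compact cD ball_quot_compact _.
Qed.

(** The sphere goes to proper faces, and [f] never raises the dimension of a carrier. *)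
Lemma ball_map_boundary v : sqnorm (val v) = 1 ->
  (odim (morse_carrier (ball_map v)) < p)%N.
Proof.
move=> v1; have v1' := unit_ballP v.
rewrite morse_carrierE; apply: leq_ltn_trans (red_dim redf _) _.
apply: (carrier_face x (ball_simp_in v1')).2 => /(ball_simp_pos v1').
by rewrite v1 ltxx.
Qed.

Hypothesis crit : ~ matched M o.

Lemma ball_map_interior v : sqnorm (val v) < 1 ->
  [/\ positive (ball_simp (val v)),
    f (chi x (ball_simp (val v))) = chi x (ball_simp (val v)) &
    morse_carrier (ball_map v) = o].
Proof.
move=> v1; have v1' := unit_ballP v.
have pos : positive (ball_simp (val v)) by exact/(ball_simp_pos v1').
have cE : carrier (chi x (ball_simp (val v))) = o.
  by rewrite carrierE ?xo//; exact: ball_simp_in.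
have fE : f (chi x (ball_simp (val v))) = chi x (ball_simp (val v)).
  by apply: (red_fixed redf); rewrite cE.
by split=> //; rewrite morse_carrierE fE.
Qed.

Lemma ball_map_cell v : critical_cell o (ball_map v) -> sqnorm (val v) < 1.
Proof.
move=> vo; rewrite lt_neqAle unit_ballP andbT; apply/eqP => v1.
by have := ball_map_boundary v1; rewrite vo -xo odim_of ltnn.
Qed.

(** [f] fixes the points of the open critical cell, so equality in the quotient is equality in
    [|X|], which for interior points means a symmetry of [x]. *)
Lemma ball_map_inj v w : sqnorm (val v) < 1 -> sqnorm (val w) < 1 ->
  ball_map v = ball_map w -> ball_pi G v = ball_pi G w.
Proof.
move=> v1 w1 /projP/fibersP.
have [vpos -> _] := ball_map_interior v1; have [_ -> _] := ball_map_interior w1.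
have vin := ball_simp_in (unit_ballP v); have win := ball_simp_in (unit_ballP w).
move=> /(chi_pos vin vpos win)[t [tx wE]]; have [s sE] := perm_of_inj t.
apply/ball_piP/asboolP.
have sx : s \in aut_group x by apply/simplex_autP; rewrite -sE.
exists (orth_mx R s^-1); first by exists s^-1%g => //; exact: (groupVr sx).
apply: ball_simp_inj; first exact: unit_ballP.
  by rewrite sqnorm_orth; exact: unit_ballP.
by rewrite ball_simp_perm invgK -sE.
Qed.

Lemma ball_map_surj z : critical_cell o z ->
  exists2 v, sqnorm (val v) < 1 & ball_map v = z.
Proof.
have [y [<- fy yE]] := critical_cell_rep z.
rewrite /critical_cell /= -yE -xo => /carrier_rep[a [pa a0 ->]].
have [b b1 bE] := ball_simp_surj pa.
have bb : unit_ball R p b := b1.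
exists (SigSub (mem_set bb)); last by rewrite /ball_map /= bE.
by apply/(ball_simp_pos b1); rewrite bE.
Qed.

(** Local closedness follows: the cell is the closed image of the ball minus the closed image of the
    sphere. *)
Lemma char_map_sphere : char_map @` sphere_quot G =
  (char_map @` [set: ball_quot G]) `\` critical_cell o.
Proof.
apply/seteqP; split=> [_ [_ [v v1 <-] <-]|_ [[z _ <-]]].
  split; first by exists (ball_pi G v).
  by rewrite char_mapE => /ball_map_cell; rewrite v1 ltxx.
have [v <-] := ball_pi_surj z; rewrite char_mapE => nv.
exists (ball_pi G v); last exact: char_mapE.
exists v => //=; apply/eqP; rewrite eq_le unit_ballP leNgt /=.
by apply/negP => /ball_map_interior[_ _].
Qed.

Lemma sphere_quot_closed : closed (sphere_quot G).
Proof.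
apply: closed_ball_quot.
rewrite (_ : _ @^-1` _ = (fun v : unit_ball R p => sqnorm (val v)) @^-1` [set 1]).
  apply: preimage_closed; last first.
    by apply: compact_closed; [exact: Rhausdorff|exact: compact_set1].
  move=> v _; apply: (@continuous_comp _ _ _ (val : unit_ball R p -> 'cV[R]_p)).
    exact: (@initial_continuous _ _ (set_val : unit_ball R p -> 'cV[R]_p)).
  exact: sqnorm_continuous.
apply/seteqP; split=> [v [w w1 /ball_piP/asboolP[_ [s _ <-] vE]]|v v1].
  by rewrite /preimage /= -w1 vE sqnorm_orth.
by exists v.
Qed.

Lemma critical_cell_locally_closed : locally_closed (critical_cell o).
Proof.
exists (~` (char_map @` sphere_quot G)), (char_map @` [set: ball_quot G]); split.
- by rewrite openC; exact/char_map_closed/sphere_quot_closed.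
- exact/char_map_closed/closedT.
rewrite char_map_sphere; apply/seteqP; split=> [z zo|z [zn zi]].
  split; first by move=> [_].
  have [v _ <-] := ball_map_surj zo; exists (ball_pi G v) => //.
  exact: char_mapE.
by apply: contrapT => nz; apply: zn.
Qed.

Lemma char_map_homeo :
  maps_homeomorphically char_map (open_ball_quot G) (critical_cell o).
Proof.
have openE u : critical_cell o (char_map u) -> open_ball_quot G u.
  have [v <-] := ball_pi_surj u; rewrite char_mapE => /ball_map_cell v1.
  by exists v.
have inj : set_inj (open_ball_quot G) char_map.
  move=> _ _ /set_mem[v v1 <-] /set_mem[w w1 <-]; rewrite !char_mapE.
  exact: ball_map_inj.
have fun_cell u : open_ball_quot G u -> critical_cell o (char_map u).
  by move=> [v v1 <-]; rewrite char_mapE; case: (ball_map_interior v1).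
have surj z : critical_cell o z -> exists2 u, open_ball_quot G u & char_map u = z.
  move=> /ball_map_surj[v v1 <-]; exists (ball_pi G v); last exact: char_mapE.
  by exists v.
split.
- by split=> // z /surj[u uo uz]; exists u.
- exact/continuous_subspaceT/char_map_continuous.
have [z0|nz0] := pselect (critical_cell o !=set0); last first.
  exists (fun _ => ball_pi G (SigSub (mem_set (unit_ball0 R p)))).
    by apply/continuous_subspaceT; exact: cst_continuous.
  by move=> u /fun_cell uo; case: nz0; exists (char_map u).
have /choice[g gP] z : exists u, critical_cell o z ->
    open_ball_quot G u /\ char_map u = z.
  have [/surj[u uo uz]|nz] := pselect (critical_cell o z); first by exists u.
  by have [z1 /surj[u _ _]] := z0; exists u.
exists g; last first.
  move=> u uo; have [go gE] := gP _ (fun_cell _ uo).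
  by apply: inj => //; exact: mem_set.
apply/continuous_closedP => D cD; apply/closed_subspaceP.
(* The characteristic map is closed, and by [openE] every point of [D] lying over the cell is in the
   open ball, where the map is injective. So the preimage of [D] under [g] is the trace of this
   closed set. *)
exists (char_map @` D); first exact: char_map_closed.
apply/seteqP; split=> z [zD zo]; split=> //.
  case: zD zo => u uD <- uo; have [go gE] := gP _ uo.
  have gu : g (char_map u) = u.
    by apply: inj => //; apply: mem_set => //; exact: openE.
  by suff : D (g (char_map u)) by []; rewrite gu.
by have [go gE] := gP _ zo; exists (g z).
Qed.

End CharacteristicMap.

Definition critical : Type := [set o : sorbit X | ~ matched M o].

Definition mk_critical o (no : [set o | ~ matched M o] o) : critical :=
  SigSub (mem_set no).

Lemma critical_unmatched (i : critical) : ~ matched M (val i).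
Proof. by case: i => o /= /set_mem. Qed.

Lemma critical_finite : finite_set [set: critical].
Proof.
rewrite (_ : [set: critical] = val @^-1` [set: sorbit X]); last by apply/seteqP; split.
apply: finite_preimage; last exact: sorbit_finite.
by move=> i j _ _; exact: val_inj.
Qed.

Definition critical_simplex (i : critical) : cells X (odim (val i)).+1 :=
  tagged (orep (val i)).

Lemma critical_simplexE i : sorbit_of (mk_simplex (critical_simplex i)) = val i.
Proof. by rewrite -[RHS]orepK /critical_simplex /odim; case: (orep _). Qed.

Lemma critical_partition :
  partition [set: critical] (fun i => critical_cell (val i)) [set: Y].
Proof.
split.
- apply/seteqP; split=> // z _.
  by exists (mk_critical (@morse_carrier_unmatched z)).
- by move=> i j _ _ [z [zi zj]]; apply: val_inj; rewrite -zi -zj.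
move=> i _; pose x := critical_simplex i.
exists (ball_map x (SigSub (mem_set (unit_ball0 R _)))).
have xi := critical_simplexE i; have ni : ~ matched M (val i) := @critical_unmatched i.
case: (ball_map_interior xi ni (v := SigSub (mem_set (unit_ball0 R _)))) => //=.
by rewrite sqnorm0 ltr01.
Qed.

Lemma critical_boundary_dim (i j : critical) :
  critical_cell (val j) `&` (char_map (x := critical_simplex i) @`
    sphere_quot (orth_group R (aut_group (critical_simplex i)))) !=set0 ->
  (odim (val j) < odim (val i))%N.
Proof.
move=> [_ [<- [_ [v v1 <-] <-]]]; rewrite char_mapE.
exact: ball_map_boundary.
Qed.

(** There are finitely many cells, so [A] is a finite union of its intersections with their
    closures. *)
Lemma critical_closed (A : set Y) :
  closed A <-> forall i : critical, closed (A `&` closure (critical_cell (val i))).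
Proof.
split=> [cA i|cA]; first by apply: closedI => //; exact: closed_closure.
rewrite (_ : A = \bigcup_(i in [set: critical])
    (A `&` closure (critical_cell (val i)))).
  by apply: closed_bigcup => [|i _]; [exact: critical_finite|exact: cA].
apply/seteqP; split=> [z Az|z [i _ []//]].
exists (mk_critical (@morse_carrier_unmatched z)) => //; split=> //.
exact: subset_closure.
Qed.

Definition morse_complex : symmetric_CW R Y := SymmetricCW
  morse_hausdorff
  critical_partition
  (fun i => critical_cell_locally_closed (critical_simplexE i) (@critical_unmatched i))
  (fun i => @char_map_continuous _ (critical_simplex i))
  (fun i => char_map_homeo (critical_simplexE i) (@critical_unmatched i))
  (fun i => sub_finite_set (@subsetT _ _) critical_finite)
  critical_boundary_dim
  critical_closed.

End CriticalCells.

Theorem theorem1p2 (R : realType) (X : sym_delta_complex)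
    (M : set (sorbit X * sorbit X)) :
  finite_set [set: simplex X] ->
  [set: simplex X] !=set0 ->
  matching M ->
  acyclic_matching M ->
  permissible_matching M ->
  exists (Y : topologicalType) (K : symmetric_CW R Y),
    homotopy_equivalent R (realization R X) Y /\
    exists2 phi : cw_index K -> sorbit X,
      set_bij [set: cw_index K] [set o | ~ matched M o] phi &
      forall (i : cw_index K) (p : nat) (sigma : cells X p.+1),
        phi i = sorbit_of (mk_simplex sigma) ->
        cw_dim i = p /\ group_isomorphic (cw_group i) (simplex_aut sigma).
Proof.
move=> finX _ mM acycM permM.
have [f rf] := @reduction_exists R X finX M mM acycM permM.
exists (quo (fibers f)), (morse_complex finX rf); split; first exact: red_equiv rf.
exists val; first split.
- by move=> i _; exact: critical_unmatched.
- by move=> i j _ _; exact: val_inj.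
- by move=> o no; exists (mk_critical no).
(* [sigma] is an arbitrary simplex of the orbit, while the group of the cell was built from the
   chosen representative. *)
move=> i p sigma iE.
exact: (@orbit_group_isomorphic _ R (mk_simplex (critical_simplex i))
  (mk_simplex sigma) (etrans (critical_simplexE i) iE)).
Qed.
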